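(* Let $K$ be a field, $S=K[x_1,x_2,x_3]$, and let $I\subset S$ be a monomial ideal. Let $\mathcal{P}(S)$ be the set of monomial prime ideals of $S$. The following conditions are equivalent: (a) $I$ is polymatroidal. (b) $I$ is polymatroidal and satisfies the strong exchange property. (c) For all $P\in\mathcal{P}(S)$ the ideal $I(P)$ has a linear resolution.
   Context: For a monomial ideal $I$, $G(I)$ denotes its unique minimal set of monomial generators, and $\deg_{x_i}(u)$ is the exponent of $x_i$ in the monomial $u$. $I$ is ''generated in a single degree'' if all elements of $G(I)$ have the same degree. A monomial ideal $I$ is polymatroidal if it is generated in a single degree and, for all $u,v\in G(I)$ and every $i$ with $\deg_{x_i}(u)>\deg_{x_i}(v)$, there exists $j$ with $\deg_{x_j}(u)<\deg_{x_j}(v)$ such that $x_j(u/x_i)\in I$. A monomial ideal $I$ satisfies the strong exchange property if $I$ is generated in a single degree and for all $u,v\in G(I)$ and for all $i,j$ with $\deg_{x_i}(u)>\deg_{x_i}(v)$ and $\deg_{x_j}(u)<\deg_{x_j}(v)$, one has $x_j(u/x_i)\in I$. Monomial prime ideals of $K[x_1,\ldots,x_n]$ are the ideals $P_C=(x_i : i\notin C)$ for $C\subseteq\{1,\ldots,n\}$ (here $n=3$). The monomial localization $I(P_C)$ is the monomial ideal obtained from $I$ by substituting $x_i\mapsto 1$ for all $i\in C$. A graded ideal $L$ has a linear resolution if for some $d$ it has a $d$-linear resolution, i.e. $\mathrm{Tor}_i^S(L,K)_j=0$ for all $i$ and all $j\neq i+d$. *)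

(* Defs.v *)
From HB Require Import structures.
From mathcomp Require Import all_boot all_order all_algebra.
From mathcomp Require Import mpoly.

Set Implicit Arguments.
Unset Strict Implicit.
Unset Printing Implicit Defensive.

Import GRing.Theory.
Local Open Scope ring_scope.

Section Ideals.
Context {K : fieldType} {n : nat}.
Local Notation S := {mpoly K[n]}.

(* Ideals are Prop-valued predicates on S, compared pointwise. *)
Definition same_ideal (I J : S -> Prop) : Prop := forall p, I p <-> J p.

Definition ideal_gen (G : S -> Prop) (p : S) : Prop :=
  exists2 s : seq (S * S),
    (forall x, x \in s -> G x.2) & p = \sum_(x <- s) x.1 * x.2.

Definition monomial_ideal_gen (A : 'X_{1..n} -> Prop) : S -> Prop :=
  ideal_gen (fun g => exists2 m, A m & g = 'X_[m]).

Definition generates (A : 'X_{1..n} -> Prop) (I : S -> Prop) : Prop :=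
  same_ideal I (monomial_ideal_gen A).

Definition monomial_ideal (I : S -> Prop) : Prop := exists A, generates A I.

Definition minimal_generating_set (A : 'X_{1..n} -> Prop) (I : S -> Prop) :
    Prop :=
  generates A I /\
  (forall B, (forall m, B m -> A m) -> generates B I -> forall m, A m -> B m).

(* The set G(I); a monomial ideal has exactly one minimal generating set of
   monomials. *)
Definition mingens (I : S -> Prop) (m : 'X_{1..n}) : Prop :=
  exists2 A, minimal_generating_set A I & A m.

Definition single_degree (I : S -> Prop) : Prop :=
  forall u v, mingens I u -> mingens I v -> mdeg u = mdeg v.

(* The exponent of x_j (u / x_i). The subtraction on exponents is truncated;
   it is only used when x_i divides u. *)
Definition exchange (u : 'X_{1..n}) (i j : 'I_n) : 'X_{1..n} :=
  (u - U_(i) + U_(j))%MM.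

Definition polymatroidal (I : S -> Prop) : Prop :=
  [/\ monomial_ideal I, single_degree I &
      forall u v, mingens I u -> mingens I v ->
      forall i, (v i < u i)%N ->
      exists2 j, (u j < v j)%N & I 'X_[exchange u i j]].

Definition strong_exchange (I : S -> Prop) : Prop :=
  [/\ monomial_ideal I, single_degree I &
      forall u v, mingens I u -> mingens I v ->
      forall i j, (v i < u i)%N -> (u j < v j)%N -> I 'X_[exchange u i j]].

Definition prime_of (C : {set 'I_n}) : S -> Prop :=
  ideal_gen (fun g => exists2 i, i \notin C & g = 'X_i).

Definition monomial_prime (P : S -> Prop) : Prop :=
  exists C, same_ideal P (prime_of C).

Definition subst_one (C : {set 'I_n}) (p : S) : S :=
  p \mPo [tuple (if i \in C then 1 else 'X_i) | i < n].

(* I(P), as an ideal of S. The set C is determined by P = P_C. *)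
Definition localization (I P : S -> Prop) : S -> Prop :=
  ideal_gen (fun g => exists C p,
    [/\ same_ideal P (prime_of C), I p & g = subst_one C p]).

End Ideals.

(* An augmented complex ... -> F_2 -> F_1 -> F_0 -> S of free modules of finite
   rank, with F_i = (+)_k S(- shift i k). Elements of F_i are row vectors, and
   maps act by multiplication on the right. *)
Record augmented_sequence (K : fieldType) (n : nat) := AugmentedSequence {
  rank : nat -> nat;
  shift : forall i, 'I_(rank i) -> int;
  diff : forall i, 'M[{mpoly K[n]}]_(rank i.+1, rank i);
  augm : 'cV[{mpoly K[n]}]_(rank 0)
}.

Section Tor.
Context {K : fieldType} {n : nat}.
Local Notation S := {mpoly K[n]}.
Implicit Types (F : augmented_sequence K n) (L : S -> Prop).

(* The maps are homogeneous of degree 0. *)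
Definition graded F : Prop :=
  (forall k m, m \in msupp (augm F k 0) -> shift k = (mdeg m)%:Z) /\
  (forall i k l m, m \in msupp (diff F i k l) ->
     shift k = shift l + (mdeg m)%:Z).

Definition cycle F (i : nat) : 'rV[S]_(rank F i) -> Prop :=
  match i with
  | 0 => fun v => v *m augm F = 0
  | i'.+1 => fun v => v *m diff F i' = 0
  end.

Definition graded_free_resolution F L : Prop :=
  [/\ graded F,
      forall p, L p <-> exists v : 'rV[S]_(rank F 0), p%:M = v *m augm F &
      forall i (v : 'rV[S]_(rank F i)),
        cycle v <-> exists w, v = w *m diff F i].

(* F_i (x) K is K^(rank F i), K being S / (x_1, ..., x_n), so the differential
   of F (x) K is given by the constant terms of the entries. *)
Definition tensor_diff F (i : nat) : 'M[K]_(rank F i.+1, rank F i) :=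
  map_mx (mcoeff 0%MM) (diff F i).

Definition tensor_cycle F (i : nat) : 'rV[K]_(rank F i) -> Prop :=
  match i with
  | 0 => fun=> True
  | i'.+1 => fun v => v *m tensor_diff F i' = 0
  end.

Definition in_degree F (i : nat) (j : int) (v : 'rV[K]_(rank F i)) : Prop :=
  forall k, v 0 k != 0 -> shift k = j.

(* H_i(F (x) K)_j = 0 *)
Definition tensor_homology_vanishes F (i : nat) (j : int) : Prop :=
  forall v : 'rV[K]_(rank F i), in_degree j v -> tensor_cycle v ->
  exists2 w : 'rV[K]_(rank F i.+1), in_degree j w & v = w *m tensor_diff F i.

(* Tor_i^S(L, K)_j = 0. As Tor does not depend on the resolution, it is
   computed from any one of them. *)
Definition tor_vanishes L (i : nat) (j : int) : Prop :=
  exists2 F, graded_free_resolution F L & tensor_homology_vanishes F i j.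

Definition linear_resolution L : Prop :=
  exists d : int, forall (i : nat) (j : int),
    j != i%:Z + d -> tor_vanishes L i j.

End Tor.

(* Main.v *)
Require Import Defs.
From mathcomp Require Import all_boot all_order all_algebra.
From mathcomp Require Import mpoly.
From mathcomp Require Import zify ring.
From Stdlib Require Import Classical.

(** The exchange condition is compared with linearity through the strong exchange
    property, which in three variables is equivalent to both.

    Polymatroidal implies strong exchange by an elementary argument on exponent
    vectors ([polymatroid_strong]): with only three coordinates, repeated
    exchanges in [v] lead to the desired exchange of [u].

    Strong exchange implies linear resolutions. It passes to localizations,
    which are generated by the generators of largest degree in the inverted
    variables ([localized_gensP], [localized_gens_exchanging]). Order the
    generators of such an ideal lexicographically. Each colon ideal of the
    previous generators by the next one is generated by variables, and never by
    the last variable, so by at most two of them ([colon_varsP],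
    [size_colon_vars]). It has an explicit Koszul resolution, and adding the
    generators one by one with mapping cones builds a resolution of the ideal all
    of whose maps are linear ([linear_quotient_step],
    [strongly_exchanging_linear]).

    Conversely, let all localizations have linear resolutions. A diagram chase
    between the given resolution and Koszul complexes turns the vanishing of Tor
    into statements on monomials: generators live in one degree [d]
    ([tor0_generator]); if [x^b] is not in [I] but all [x^b x_i] are, then [b] has
    degree [d - 1] ([tor2_socle]); and the analogue holds in two variables for the
    localizations at one variable ([tor1_syzygy]). So a monomial of degree at
    least [d] outside [I] can be multiplied by variables forever without entering
    [I], and stays outside the localization of [I] at some variable
    ([saturation]). Using this twice, a monomial of degree [d] is in [I] as soon
    as it satisfies lower bounds on its exponents and on the sums of two of them
    that hold on all generators. These bounds survive exchanges, whence the strong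
    exchange property ([linear_strong_exchange]). *)

Set Implicit Arguments.
Unset Strict Implicit.
Unset Printing Implicit Defensive.
Import GRing.Theory Order.TTheory.
Local Open Scope ring_scope.

(** * Polynomials with prescribed support *)

Section Support.
Context {K : fieldType} {n : nat}.
Local Notation S := {mpoly K[n]}.
Implicit Types (p q : S) (m u : 'X_{1..n}) (P Q : pred 'X_{1..n}).
Implicit Types (M N : 'X_{1..n} -> Prop) (i j : 'I_n).

Definition supported M p : Prop := forall m, m \in msupp p -> M m.

Lemma supported0 M : supported M 0.
Proof. by move=> m; rewrite msupp0. Qed.

Lemma supportedD M p q : supported M p -> supported M q -> supported M (p + q).
Proof. by move=> Hp Hq m /msuppD_le; rewrite mem_cat => /orP[/Hp|/Hq]. Qed.

Lemma supportedN M p : supported M p -> supported M (- p).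
Proof. by move=> Hp m; rewrite (perm_mem (msuppN p)) => /Hp. Qed.

Lemma supportedX M m : supported M 'X_[m] <-> M m.
Proof.
split=> [|Mm k]; first by apply; rewrite msuppX mem_head.
by rewrite msuppX inE => /eqP->.
Qed.

Lemma supported_sum (T : Type) (r : seq T) (A : pred T) (F : T -> S) M :
  (forall x, A x -> supported M (F x)) ->
  supported M (\sum_(x <- r | A x) F x).
Proof.
move=> HF; elim/big_rec: _ => [|x p Ax Hp]; first exact: supported0.
by apply: supportedD => //; apply: HF.
Qed.

Lemma supportedM M1 M2 M p q :
  (forall m1 m2, M1 m1 -> M2 m2 -> M (m1 + m2)%MM) ->
  supported M1 p -> supported M2 q -> supported M (p * q).
Proof.
move=> HM Hp Hq m /msuppM_le /allpairsP[[m1 m2] /= [/Hp M1m /Hq M2m ->]].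
exact: HM.
Qed.

Lemma supportedW M N p :
  supported M p -> (forall m, M m -> N m) -> supported N p.
Proof. by move=> Hp MN m /Hp /MN. Qed.

Definition mfilter P p : S := \sum_(m <- msupp p | P m) p@_m *: 'X_[m].

Lemma mcoeff_mfilter P p m : (mfilter P p)@_m = if P m then p@_m else 0.
Proof.
rewrite raddf_sum /=; under eq_bigr => k _ do rewrite mcoeffZ mcoeffX.
case: ifPn => Pm; last first.
  rewrite big1 // => k Pk; case: eqVneq => [km|_]; last by rewrite mulr0.
  by rewrite -km Pk in Pm.
have [mp|mp] := boolP (m \in msupp p).
  rewrite -big_filter (bigD1_seq m) ?mem_filter ?Pm ?filter_uniq //= eqxx mulr1.
  by rewrite big1 ?addr0 // => k /negPf ->; rewrite mulr0.
rewrite (memN_msupp_eq0 mp) big1_seq // => k /andP[_ kp].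
case: eqVneq => [km|_]; last by rewrite mulr0.
by rewrite -km kp in mp.
Qed.

Lemma mfilterD P p q : mfilter P (p + q) = mfilter P p + mfilter P q.
Proof.
by apply/mpolyP=> m; rewrite mcoeffD !mcoeff_mfilter mcoeffD; case: ifP;
  rewrite ?addr0.
Qed.

Lemma msupp_mfilter P p m : (m \in msupp (mfilter P p)) = (m \in msupp p) && P m.
Proof.
rewrite !mcoeff_msupp mcoeff_mfilter; case: (P m); rewrite ?andbT //.
by rewrite andbF eqxx.
Qed.

Lemma mfilter_supported P p : supported P (mfilter P p).
Proof. by move=> m; rewrite msupp_mfilter => /andP[]. Qed.

Lemma mfilter_id P p : supported P p -> mfilter P p = p.
Proof.
move=> Hp; apply/mpolyP=> m; rewrite mcoeff_mfilter; case: ifPn => // Pm.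
by rewrite memN_msupp_eq0 //; apply: contraNN Pm; apply: Hp.
Qed.

Lemma mfilter_eq0 P p : supported (fun m => ~~ P m) p -> mfilter P p = 0.
Proof.
move=> Hp; apply/mpolyP=> m; rewrite mcoeff_mfilter mcoeff0; case: ifPn => // Pm.
by rewrite memN_msupp_eq0 //; apply/negP => /Hp /=; rewrite Pm.
Qed.

Lemma mfilter_split P p : p = mfilter P p + mfilter (fun m => ~~ P m) p.
Proof.
apply/mpolyP=> m; rewrite mcoeffD !mcoeff_mfilter /=.
by case: (P m); rewrite ?addr0 ?add0r.
Qed.

Lemma mfilterM P Q p q :
  (forall m1 m2, m2 \in msupp q -> Q (m1 + m2)%MM = P m1) ->
  mfilter Q (p * q) = mfilter P p * q.
Proof.
move=> PQ; rewrite {1}(mfilter_split P p) mulrDl mfilterD [X in X + _]mfilter_id.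
  rewrite [X in _ + X]mfilter_eq0 ?addr0 //.
  apply: (@supportedM (fun m => ~~ P m) (fun m => m \in msupp q)) => [m1 m2 /= ? ?||//].
    by rewrite PQ.
  exact: mfilter_supported.
apply: (@supportedM P (fun m => m \in msupp q)) => [m1 m2 /= ? ?||//].
  by rewrite PQ.
exact: mfilter_supported.
Qed.

Lemma mfilter_sum P (T : Type) (r : seq T) (A : pred T) (F : T -> S) :
  mfilter P (\sum_(x <- r | A x) F x) = \sum_(x <- r | A x) mfilter P (F x).
Proof.
apply: (big_morph _ (mfilterD P)).
by rewrite mfilter_eq0 //; apply: supported0.
Qed.

Lemma mcoeffMXE p u m :
  (p * 'X_[u])@_m = if (u <= m)%MM then p@_(m - u) else 0.
Proof.
case: ifPn => um.
  by rewrite -{1}(submK um) addmC mcoeffMX.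
rewrite memN_msupp_eq0 // (perm_mem (msuppMX p u)); apply/negP => /mapP[v _ mE].
by rewrite mE lem_addr in um.
Qed.

Lemma supportedMX M p u :
  supported M (p * 'X_[u]) <-> supported (fun m => M (u + m)%MM) p.
Proof.
split=> H m mp; first by apply: H; rewrite (perm_mem (msuppMX p u)) map_f.
by move: mp; rewrite (perm_mem (msuppMX p u)) => /mapP[k /H Mk ->].
Qed.

Lemma supported_dvdP p u :
  supported (fun m => (u <= m)%MM) p <-> exists q, p = q * 'X_[u].
Proof.
split=> [Hp|[q ->]]; last by apply/supportedMX => m _ /=; rewrite lem_addr.
exists (\sum_(m <- msupp p) p@_m *: 'X_[m - u]); rewrite mulr_suml.
rewrite {1}(mpolyE p) !big_seq; apply: eq_bigr => m /Hp um.
by rewrite -scalerAl -mpolyXD submK.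
Qed.

(** The remainder inherits every constraint on the support of [p], so that
    divisions by several variables can be iterated. *)
Lemma div_var i p : exists q r : S, p = q * 'X_i + r /\
  (forall M, supported M p -> supported (fun m => M m /\ m i = 0%N) r).
Proof.
pose P := fun m => (0 < m i)%N.
have /supported_dvdP[q qE] : supported (fun m => (U_(i) <= m)%MM) (mfilter P p).
  by apply: (supportedW (@mfilter_supported P p)) => m; rewrite lep1mP /P -lt0n.
exists q, (mfilter (fun m => ~~ P m) p); split; first by rewrite -qE -mfilter_split.
move=> M Mp m; rewrite msupp_mfilter => /andP[/Mp Mm].
by rewrite /= -leqNgt leqn0 => /eqP.
Qed.

Lemma dvd_free_eq0 i q r :
  supported (fun m => m i = 0%N) r -> q * 'X_i = r -> r = 0.
Proof.
move=> r0 qr; apply/eqP; rewrite -msupp_eq0.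
case E: (msupp r) => [//|m s]; have mr : m \in msupp r by rewrite E mem_head.
have /supported_dvdP/(_ m mr) : exists q', r = q' * 'X_[U_(i)] by exists q.
by rewrite lep1mP r0.
Qed.

Lemma mulXI i p q : p * 'X_i = q * 'X_i -> p = q.
Proof.
move=> E; apply/mpolyP=> m.
by rewrite -(mcoeffMX p U_(i)) E mcoeffMX.
Qed.

Lemma freeMX i j r : i != j -> supported (fun m => m i = 0%N) r ->
  supported (fun m => m i = 0%N) (r * 'X_j).
Proof.
move=> ij Hr; apply/supportedMX; apply: (supportedW Hr) => m m0.
by rewrite mnmDE mnm1E m0 eq_sym (negPf ij).
Qed.

(** Exactness of the Koszul complex of two variables. The remainder of [q] modulo
    [x_i] stays free of [x_i] after multiplication by [x_j], whereas the relation
    makes that product divisible by [x_i]; so it vanishes. *)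
Lemma koszul2 i j p q : i != j -> p * 'X_i + q * 'X_j = 0 ->
  exists r, p = r * 'X_j /\ q = - r * 'X_i.
Proof.
move=> ij E.
have [a [b [qE /(_ (fun _ => True) (fun _ _ => I)) bf]]] := div_var i q.
have b0 : b * 'X_j = 0.
  apply: (@dvd_free_eq0 i (- p - a * 'X_j)).
    by apply: freeMX => //; apply: (supportedW bf) => m [].
  rewrite qE in E; apply/eqP; rewrite -subr_eq0; apply/eqP.
  by rewrite -[RHS]oppr0 -E; ring.
have {b0} b0 : b = 0 by apply: (@mulXI j); rewrite b0 mul0r.
exists (- a); rewrite opprK qE b0 addr0; split=> //.
apply: (@mulXI i); apply/eqP; rewrite -subr_eq0 -E qE b0; apply/eqP; ring.
Qed.

(** Exactness of the Koszul complex of three variables in homological degree one,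
    boundaries being cross products of [(a, b, c)] with the vector of variables.
    Modulo [x_k] the relation involves two variables only, which [koszul2]
    settles; the quotients by [x_k] then determine [r]. *)
Lemma koszul3_1 i j k p q r : i != j -> i != k -> j != k ->
  p * 'X_i + q * 'X_j + r * 'X_k = 0 ->
  exists a b c, [/\ p = c * 'X_j - b * 'X_k, q = a * 'X_k - c * 'X_i
                  & r = b * 'X_i - a * 'X_j].
Proof.
move=> ij ik jk E.
have [a [p' [pE /(_ (fun _ => True) (fun _ _ => I)) pf]]] := div_var k p.
have [b [q' [qE /(_ (fun _ => True) (fun _ _ => I)) qf]]] := div_var k q.
have F0 : p' * 'X_i + q' * 'X_j = 0.
  apply: (@dvd_free_eq0 k (- r - a * 'X_i - b * 'X_j)).
    by apply: supportedD; apply: freeMX; rewrite 1?eq_sym //;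
      [apply: (supportedW pf) | apply: (supportedW qf)] => m [].
  apply/eqP; rewrite -subr_eq0 -oppr_eq0 -E pE qE; apply/eqP; ring.
have [c [p'E q'E]] := koszul2 ij F0.
have rE : r = - a * 'X_i - b * 'X_j.
  apply: (@mulXI k); apply/eqP; rewrite -subr_eq0 -E pE qE p'E q'E; apply/eqP.
  ring.
by exists b, (- a), c; split; rewrite ?pE ?qE ?p'E ?q'E ?rE; ring.
Qed.

(** Homological degree two: the first relation makes [q] and [r] the multiples of
    [x_j] and [x_k] by one factor, and the second one extends this to [p]. *)
Lemma koszul3_2 i j k p q r : i != j -> i != k -> j != k ->
  r * 'X_j - q * 'X_k = 0 -> p * 'X_k - r * 'X_i = 0 ->
  exists s, [/\ p = s * 'X_i, q = s * 'X_j & r = s * 'X_k].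
Proof.
move=> ij ik jk E1 E2.
have [|s [rE qE]] := @koszul2 j k r (- q) jk; first by rewrite mulNr.
have qE' : q = s * 'X_j by rewrite -[q]opprK qE mulNr opprK.
exists s; split=> //; apply: (@mulXI k); apply/eqP; rewrite -subr_eq0 -E2 rE.
apply/eqP; ring.
Qed.

End Support.

(** * Homogeneous rows and the Koszul complex on rows *)

Section Homogeneous.
Context {K : fieldType} {n : nat}.
Local Notation S := {mpoly K[n]}.

(** The function [s] gives the degrees of the basis elements of a graded free
    module, [e] the degree of the row. *)
Definition homrow r (s : 'I_r -> int) (e : int) (v : 'rV[S]_r) : Prop :=
  forall k, supported (fun m => s k + (mdeg m)%:Z = e) (v 0 k).

(** Graded maps of degree zero between free modules with basis degrees [s] and
    [t]. *)
Definition hommx r c (s : 'I_r -> int) (t : 'I_c -> int) (A : 'M[S]_(r, c)) :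
    Prop :=
  forall k l, supported (fun m => s k = t l + (mdeg m)%:Z) (A k l).

Lemma homrowD r s e (v w : 'rV_r) :
  homrow s e v -> homrow s e w -> homrow s e (v + w).
Proof. by move=> Hv Hw k; rewrite mxE; apply: supportedD. Qed.

Lemma homrowN r s e (v : 'rV_r) : homrow s e v -> homrow s e (- v).
Proof. by move=> Hv k; rewrite mxE; apply: supportedN. Qed.

Lemma homrowX r s e (v : 'rV_r) i :
  homrow s e v -> homrow s (e + 1) ('X_i *: v).
Proof.
move=> Hv k; rewrite mxE mulrC; apply/supportedMX.
apply: (supportedW (Hv k)) => m E; rewrite mdegD mdeg1; lia.
Qed.

(** A graded map hits a homogeneous row as soon as it hits it at all, because
    the component of the right degree of a preimage is again a preimage. *)
Lemma homog_lift r c (s : 'I_r -> int) (t : 'I_c -> int) A e (w : 'rV[S]_r) :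
  hommx s t A -> homrow t e (w *m A) ->
  exists2 w', homrow s e w' & w' *m A = w *m A.
Proof.
move=> HA Hw.
exists (\row_k mfilter (fun m => s k + (mdeg m)%:Z == e) (w 0 k)).
  by move=> k m; rewrite mxE msupp_mfilter => /andP[_ /eqP].
apply/rowP=> l; rewrite -[RHS](@mfilter_id _ _ (fun m => t l + (mdeg m)%:Z == e)).
  rewrite !mxE mfilter_sum; apply: eq_bigr => k _; rewrite mxE.
  symmetry; apply: mfilterM => m1 m2 /HA ->; rewrite mdegD.
  by apply/eqP/eqP; lia.
by apply: (supportedW (Hw l)) => m ->; apply/eqP.
Qed.

End Homogeneous.

Section Variables3.
Context {K : fieldType}.
Local Notation S := {mpoly K[3]}.
Implicit Types (i j k l : 'I_3).

Lemma ord3P i j k : i != j -> i != k -> j != k ->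
  forall l, [\/ l = i, l = j | l = k].
Proof.
move=> ij ik jk l.
have [->|li] := eqVneq l i; first by constructor 1.
have [->|lj] := eqVneq l j; first by constructor 2.
constructor 3; apply: val_inj => /=.
move: ij ik jk li lj (ltn_ord l) (ltn_ord i) (ltn_ord j) (ltn_ord k).
rewrite -!(inj_eq val_inj) /=; lia.
Qed.

(** Rows with entries in the ideal of all variables: after division by the three
    variables in turn the remainder is a constant, which has to be zero. *)
Lemma irrelevant_row i j k r (w : 'rV[S]_r) : i != j -> i != k -> j != k ->
  map_mx (mcoeff 0%MM) w = 0 ->
  exists a b c, w = 'X_i *: a + 'X_j *: b + 'X_k *: c.
Proof.
move=> ij ik jk w0.
have H (x : 'I_r) : exists abc : S * S * S,
    w 0 x = abc.1.1 * 'X_i + abc.1.2 * 'X_j + abc.2 * 'X_k.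
  have [a [p [wE Hp]]] := div_var i (w 0 x).
  have [b [q [pE Hq]]] := div_var j p.
  have [c [r0 [qE Hr]]] := div_var k q.
  exists (a, b, c); rewrite wE pE qE /=.
  suff -> : r0 = 0 by rewrite addr0 !addrA.
  apply/eqP; rewrite -msupp_eq0; case E: (msupp r0) => [//|m s].
  have mr : m \in msupp r0 by rewrite E mem_head.
  have [[[_ m1] m2] m3] := Hr _ (Hq _ (Hp (fun _ => True) (fun _ _ => I))) m mr.
  have m0 : m = 0%MM.
    by apply/mnmP=> l; rewrite mnm0E; case: (ord3P ij ik jk l) => ->.
  have /rowP/(_ x) := w0; rewrite !mxE wE pE qE !mcoeffD !mcoeffMXE.
  have ne l : (U_(l) <= (0 : 'X_{1..3}))%MM = false by rewrite lep1mP mnm0E.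
  rewrite !ne !add0r => /eqP; rewrite mcoeff_eq0 -m0 mr //.
have [f fE] := fin_all_exists H.
exists (\row_x (f x).1.1), (\row_x (f x).1.2), (\row_x (f x).2).
by apply/rowP=> x; rewrite !mxE fE; ring.
Qed.

Lemma koszul3_1_row i j k r (u v w : 'rV[S]_r) : i != j -> i != k -> j != k ->
  'X_i *: u + 'X_j *: v + 'X_k *: w = 0 ->
  exists a b c, [/\ u = 'X_j *: c - 'X_k *: b, v = 'X_k *: a - 'X_i *: c
                  & w = 'X_i *: b - 'X_j *: a].
Proof.
move=> ij ik jk E.
have H (x : 'I_r) : exists abc : S * S * S,
    [/\ u 0 x = abc.2 * 'X_j - abc.1.2 * 'X_k,
        v 0 x = abc.1.1 * 'X_k - abc.2 * 'X_i
      & w 0 x = abc.1.2 * 'X_i - abc.1.1 * 'X_j].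
  have [|a [b [c H]]] := @koszul3_1 _ _ i j k (u 0 x) (v 0 x) (w 0 x) ij ik jk.
    by have /rowP/(_ x) := E; rewrite !mxE => <-; ring.
  by exists (a, b, c).
have [f fE] := fin_all_exists H.
exists (\row_x (f x).1.1), (\row_x (f x).1.2), (\row_x (f x).2).
by split; apply/rowP=> x; rewrite !mxE; have [e1 e2 e3] := fE x;
  rewrite ?e1 ?e2 ?e3; ring.
Qed.

Lemma koszul3_2_row i j k r (u v w : 'rV[S]_r) : i != j -> i != k -> j != k ->
  'X_j *: w - 'X_k *: v = 0 -> 'X_k *: u - 'X_i *: w = 0 ->
  exists s, [/\ u = 'X_i *: s, v = 'X_j *: s & w = 'X_k *: s].
Proof.
move=> ij ik jk E1 E2.
have H (x : 'I_r) : exists s : S,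
    [/\ u 0 x = s * 'X_i, v 0 x = s * 'X_j & w 0 x = s * 'X_k].
  apply: koszul3_2 => //.
    by have /rowP/(_ x) := E1; rewrite !mxE => <-; ring.
  by have /rowP/(_ x) := E2; rewrite !mxE => <-; ring.
have [f fE] := fin_all_exists H.
exists (\row_x f x).
by split; apply/rowP=> x; rewrite !mxE; have [e1 e2 e3] := fE x;
  rewrite ?e1 ?e2 ?e3; ring.
Qed.

End Variables3.

(** * What the vanishing of Tor says about a monomial ideal *)

Section TorChase.
Context {K : fieldType}.
Local Notation S := {mpoly K[3]}.
Implicit Types (i j k l : 'I_3) (F : augmented_sequence K 3) (L : S -> Prop).
Implicit Types (M : 'X_{1..3} -> Prop) (m : 'X_{1..3}).

Lemma diff_hom F (i : nat) : graded F ->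
  hommx (@shift _ _ F i.+1) (@shift _ _ F i) (diff F i).
Proof. by move=> [_ H] k l m /H. Qed.

Lemma augm_hom F : graded F -> hommx (@shift _ _ F 0) (fun=> 0) (augm F).
Proof. by move=> [H _] k l m; rewrite ord1 => /H ->; rewrite add0r. Qed.

Lemma augm_in F L (v : 'rV[S]_(rank F 0)) : graded_free_resolution F L ->
  L ((v *m augm F) 0 0).
Proof. by move=> [_ HL _]; apply/HL; exists v; rewrite -mx11_scalar. Qed.

Lemma augm_diff F L (w : 'rV[S]_(rank F 1)) : graded_free_resolution F L ->
  w *m diff F 0 *m augm F = 0.
Proof. by move=> [_ _ /(_ 0%N (w *m diff F 0)) [_]]; apply; exists w. Qed.

Lemma diff_diff F L (i : nat) (w : 'rV[S]_(rank F i.+2)) : graded_free_resolution F L ->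
  w *m diff F i.+1 *m diff F i = 0.
Proof. by move=> [_ _ /(_ i.+1 (w *m diff F i.+1)) [_]]; apply; exists w. Qed.

Lemma augm_lift F L m : graded_free_resolution F L -> L 'X_[m] ->
  exists2 f : 'rV[S]_(rank F 0),
    homrow (@shift _ _ F 0) (mdeg m)%:Z f & f *m augm F = ('X_[m])%:M.
Proof.
move=> [Fg HL _] /HL[f fE].
have [|f' Hf' f'E] := @homog_lift _ _ _ _ _ _ _ (mdeg m)%:Z f (augm_hom Fg).
  move=> k; rewrite -fE ord1 mxE eqxx; apply/supportedX; lia.
by exists f'; rewrite ?f'E.
Qed.

Lemma cycle_lift F L (i : nat) e (v : 'rV[S]_(rank F i)) :
  graded_free_resolution F L -> homrow (@shift _ _ F i) e v -> Defs.cycle v ->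
  exists2 w : 'rV[S]_(rank F i.+1),
    homrow (@shift _ _ F i.+1) e w & v = w *m diff F i.
Proof.
move=> [Fg _ /(_ i v) [+ _]] Hv => /[apply] -[w vE].
have [|w' Hw' w'E] := @homog_lift _ _ _ _ _ _ _ e w (diff_hom Fg).
  by rewrite -vE.
by exists w'; rewrite ?w'E.
Qed.

(** How the vanishing of [Tor_i(L, K)] in degree [e] is used: the constant terms
    of [w] form a cycle of the tensored complex. They bound a row of scalars [t],
    which read as constant polynomials gives a boundary differing from [w] by a
    row over the ideal of all variables. *)
Lemma tor_step F (i : nat) e (w : 'rV[S]_(rank F i)) (x y z : 'I_3) :
  x != y -> x != z -> y != z -> tensor_homology_vanishes F i e ->
  homrow (@shift _ _ F i) e w -> tensor_cycle (map_mx (mcoeff 0%MM) w) ->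
  exists t a b c, w = t *m diff F i + ('X_x *: a + 'X_y *: b + 'X_z *: c).
Proof.
move=> xy xz yz Hv Hw cw.
have [|v _ vE] := Hv (map_mx (mcoeff 0%MM) w) _ cw.
  move=> k; rewrite mxE -mcoeff_msupp => /Hw; rewrite mdeg0; lia.
pose t := map_mx (@mpolyC 3 K) v.
have tE : map_mx (mcoeff 0%MM) t = v.
  by apply/rowP=> c; rewrite !mxE mcoeffC eqxx mulr1.
have [|a [b [c E]]] := @irrelevant_row K x y z _ (w - t *m diff F i) xy xz yz.
  by rewrite map_mxB vE map_mxM tE subrr.
by exists t, a, b, c; rewrite -E addrC subrK.
Qed.

Lemma mulX_const r (i : 'I_3) (w : 'rV[S]_r) :
  map_mx (mcoeff 0%MM) ('X_i *: w) = 0.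
Proof. by rewrite map_mxZ /= mcoeffX mnm1_eq0 scale0r. Qed.

Lemma addUCA (m : 'X_{1..3}) i j :
  (U_(i) + (m + U_(j)) = U_(j) + (m + U_(i)))%MM.
Proof. by apply/mnmP=> k; rewrite !mnmDE; lia. Qed.

(** Here the cycle is a lift of [x^a] to [F_0]. The augmentation kills its boundary
    part and leaves [x^a] as a combination of the variables with coefficients in
    [L]. *)
Lemma tor0_generator L M d (a : 'X_{1..3}) :
  (forall p, L p <-> supported M p) -> tor_vanishes L 0 d -> d = (mdeg a)%:Z ->
  M a -> exists i b, a = (b + U_(i))%MM /\ M b.
Proof.
move=> LM [F Fr Hv] dE Ma; rewrite dE in Hv.
have [f Hf fE] : exists2 f : 'rV[S]_(rank F 0),
    homrow (@shift _ _ F 0) (mdeg a)%:Z f & f *m augm F = ('X_[a])%:M.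
  by apply: augm_lift Fr _; apply/LM/supportedX.
have [t [u [v [w E]]]] := @tor_step F 0 _ f ord0 (@Ordinal 3 1 isT)
  (@Ordinal 3 2 isT) isT isT isT Hv Hf I.
have /matrixP/(_ 0 0) := fE.
rewrite E mulmxDl (augm_diff _ Fr) add0r !mulmxDl -!scalemxAl !mxE => E1.
have : a \in msupp ('X_[a] : S) by rewrite msuppX mem_head.
have -> : 'X_[a] = 'X_[a] *+ (0 == 0 :> 'I_1) :> S by []; rewrite -E1.
have G i (r : 'rV[S]_(rank F 0)) :
    supported (fun m => exists i b, m = (b + U_(i))%MM /\ M b)
   ('X_i * (r *m augm F) 0 0).
  rewrite mulrC; apply/supportedMX.
  apply: (supportedW (proj1 (LM _) (augm_in r Fr))) => m Mm.
  by exists i, m; rewrite addmC.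
move: (G ord0 u) (G (@Ordinal 3 1 isT) v) (G (@Ordinal 3 2 isT) w).
rewrite !mxE => G1 G2 G3; exact: (supportedD (supportedD G1 G2) G3).
Qed.

(** A shadow of the isomorphism of [Tor_1(L, K)] with the first Koszul homology
    of [L]. The monomials [x^b x_i] and [x^b x_j] give a Koszul cycle of [L], of
    degree [mdeg b + 2]. Lifting it to [F_0] and then to [F_1] gives an element
    [w] whose class in [Tor_1] vanishes, and the chase back exhibits the cycle as
    a boundary. As [x^b x_j] is free of [x_k], the coefficient of the boundary
    along [x_j] has to contain the monomial [x^b]. *)
Lemma tor1_syzygy L M d (b : 'X_{1..3}) i j k : i != j -> i != k -> j != k ->
  (forall p, L p <-> supported M p) ->
  tor_vanishes L 1 d -> d = (mdeg b + 2)%:Z ->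
  b k = 0%N -> M (b + U_(i))%MM -> M (b + U_(j))%MM -> M b.
Proof.
move=> ij ik jk LM [F Fr Hv] dE bk Mi Mj.
have [f Hf fE] := augm_lift Fr (proj2 (LM _) (proj2 (supportedX _ _) Mj)).
have [g Hg gE] := augm_lift Fr (proj2 (LM _) (proj2 (supportedX _ _) Mi)).
have [||w Hw wE] := @cycle_lift F L 0 d ('X_i *: f - 'X_j *: g) Fr.
- have -> : d = (mdeg (b + U_(i)))%:Z + 1 by rewrite dE mdegD mdeg1; lia.
  apply: homrowD; last exact/homrowN/homrowX.
  by apply: homrowX; move: Hf; rewrite !mdegD !mdeg1.
- rewrite /= mulmxBl -!scalemxAl fE gE !scale_scalar_mx -!mpolyXD.
  by rewrite addUCA subrr.
have [|t [u [v [x E]]]] := tor_step ij ik jk Hv Hw.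
  by rewrite /= /tensor_diff -map_mxM -wE map_mxB !mulX_const subrr.
have [|p [q [r [E1 _ _]]]] := @koszul3_1_row K i j k _ (f - u *m diff F 0)
  (- g - v *m diff F 0) (- (x *m diff F 0)) ij ik jk.
  move: wE; rewrite E mulmxDl (diff_diff _ Fr) add0r !mulmxDl -!scalemxAl.
  move=> E1; rewrite -[RHS](subrr ('X_i *: f - 'X_j *: g)) {2}E1.
  move: (u *m _) (v *m _) (x *m _) => u' v' x'.
  by apply/rowP=> y; rewrite !mxE; ring.
have := congr1 (mulmx^~ (augm F)) E1.
rewrite /= !mulmxBl (augm_diff _ Fr) subr0 fE -!scalemxAl.
have := proj1 (LM _) (augm_in r Fr).
move: (r *m _) (q *m _) => c c' Mc /matrixP/(_ 0 0).
rewrite !mxE eqxx mulr1n => /(congr1 (mcoeff (b + U_(j))%MM)).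
rewrite mcoeffB mcoeffX eqxx /= ['X_j * _]mulrC ['X_k * _]mulrC [in X in X - _]addmC.
rewrite mcoeffMX mcoeffMXE lep1mP mnmDE mnm1E bk (negPf jk) /= subr0 => E2.
by apply: Mc; rewrite mcoeff_msupp -E2 oner_eq0.
Qed.

(** The same comparison one step further: the monomials [x^b x_i] form a Koszul
    2-cycle of [L], and it bounds only if [x^b] is in [L]. Equivalently, the socle
    of [S/L] lives in the degrees that [Tor_2(L, K)] allows. *)
Lemma tor2_socle L M d (b : 'X_{1..3}) :
  (forall p, L p <-> supported M p) ->
  tor_vanishes L 2 d -> d = (mdeg b + 3)%:Z ->
  (forall i, M (b + U_(i))%MM) -> M b.
Proof.
move=> LM [F Fr Hv] dE Mb.
pose i : 'I_3 := ord0; pose j := @Ordinal 3 1 isT; pose k := @Ordinal 3 2 isT.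
have [ij ik jk] : [/\ i != j, i != k & j != k] by [].
have H l := augm_lift Fr (proj2 (LM _) (proj2 (supportedX _ _) (Mb l))).
have [f Hf fE] := H i; have [g Hg gE] := H j; have [h Hh hE] := H k.
have degE l : (mdeg (b + U_(l)))%:Z = d - 2.
  by rewrite dE mdegD mdeg1; lia.
rewrite !degE in Hf Hg Hh.
(* The components of the Koszul boundary of [(f, g, h)] map to zero in [L], so
   they come from [F_1]; the Koszul boundary of the result comes from [F_2]. *)
have L1 (x y : 'I_3) (u v : 'rV[S]_(rank F 0)) :
    homrow (@shift _ _ F 0) (d - 2) u -> homrow (@shift _ _ F 0) (d - 2) v ->
    u *m augm F = ('X_[b + U_(x)])%:M -> v *m augm F = ('X_[b + U_(y)])%:M ->
    exists2 w : 'rV[S]_(rank F 1), homrow (@shift _ _ F 1) (d - 1) w &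
      'X_y *: u - 'X_x *: v = w *m diff F 0.
  move=> Hu Hv' uE vE; apply: cycle_lift Fr _ _.
    have -> : d - 1 = d - 2 + 1 by lia.
    by apply: homrowD; [apply: homrowX|apply/homrowN/homrowX].
  rewrite /= mulmxBl -!scalemxAl uE vE !scale_scalar_mx -!mpolyXD.
  by rewrite addUCA subrr.
have [p Hp pE] := L1 _ _ _ _ Hh Hg hE gE.
have [q Hq qE] := L1 _ _ _ _ Hf Hh fE hE.
have [r Hr rE] := L1 _ _ _ _ Hg Hf gE fE.
have [||w Hw wE] := @cycle_lift F L 1 d ('X_i *: p + 'X_j *: q + 'X_k *: r) Fr.
- have -> : d = d - 1 + 1 by lia.
  by apply: homrowD; [apply: homrowD|]; apply: homrowX.
- rewrite /= !mulmxDl -!scalemxAl -pE -qE -rE.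
  by apply/rowP=> x; rewrite !mxE; ring.
have [|t [u [v [x E]]]] := tor_step ij ik jk Hv Hw.
  by rewrite /= /tensor_diff -map_mxM -wE !map_mxD !mulX_const !addr0.
have [|a1 [a2 [a3 [E1 E2 E3]]]] := @koszul3_1_row K i j k _ (p - u *m diff F 1)
  (q - v *m diff F 1) (r - x *m diff F 1) ij ik jk.
  move: wE; rewrite E mulmxDl (diff_diff _ Fr) add0r !mulmxDl -!scalemxAl.
  move=> E1.
  rewrite -[RHS](subrr ('X_i *: p + 'X_j *: q + 'X_k *: r)) {2}E1.
  move: (u *m _) (v *m _) (x *m _) => u' v' x'.
  by apply/rowP=> y; rewrite !mxE; ring.
have Z (y : 'rV[S]_(rank F 2)) (z : 'rV[S]_(rank F 1)) :
  (z - y *m diff F 1) *m diff F 0 = z *m diff F 0.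
  by rewrite mulmxBl (diff_diff _ Fr) subr0.
have [||s [_ _ sE]] := @koszul3_2_row K i j k _ (f - a1 *m diff F 0)
  (g - a2 *m diff F 0) (h - a3 *m diff F 0) ij ik jk.
- have := Z u p; rewrite -pE E1 mulmxBl -!scalemxAl.
  move: (a2 *m _) (a3 *m _) => a2' a3' E5.
  rewrite -[RHS](subrr ('X_j *: h - 'X_k *: g)) -{2}E5.
  by apply/rowP=> y; rewrite !mxE; ring.
- have := Z v q; rewrite -qE E2 mulmxBl -!scalemxAl.
  move: (a1 *m _) (a3 *m _) => a1' a3' E5.
  rewrite -[RHS](subrr ('X_k *: f - 'X_i *: h)) -{2}E5.
  by apply/rowP=> y; rewrite !mxE; ring.
have := congr1 (mulmx^~ (augm F)) sE.
rewrite /= mulmxBl (augm_diff _ Fr) subr0 hE -scalemxAl.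
have := proj1 (LM _) (augm_in s Fr).
move: (s *m _) => c Mc /matrixP/(_ 0 0).
rewrite !mxE eqxx mulr1n => /(congr1 (mcoeff (b + U_(k))%MM)).
rewrite mcoeffX eqxx /= mulrC addmC mcoeffMX => E4.
by apply: Mc; rewrite mcoeff_msupp -E4 oner_eq0.
Qed.

End TorChase.

(** * Monomial ideals, their minimal generators and localizations *)

Section MonomialIdeals.
Context {K : fieldType} {n : nat}.
Local Notation S := {mpoly K[n]}.
Implicit Types (I P : S -> Prop) (G : S -> Prop) (p q : S).
Implicit Types (A B M : 'X_{1..n} -> Prop) (a b m u v : 'X_{1..n}).

Definition up_closed M : Prop := forall a b, M a -> (a <= b)%MM -> M b.

Definition above A m : Prop := exists2 a, A a & (a <= m)%MM.

Lemma above_up A : up_closed (above A).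
Proof. by move=> a b [c Ac ca] ab; exists c => //; apply: lepm_trans ab. Qed.

Lemma ideal_gen0 G : ideal_gen G 0.
Proof. by exists [::]; rewrite ?big_nil. Qed.

Lemma ideal_genD G p q : ideal_gen G p -> ideal_gen G q -> ideal_gen G (p + q).
Proof.
move=> [s Gs ->] [t Gt ->]; exists (s ++ t); last by rewrite big_cat.
by move=> x; rewrite mem_cat => /orP[/Gs|/Gt].
Qed.

Lemma ideal_genM G p g : G g -> ideal_gen G (p * g).
Proof.
by move=> Gg; exists [:: (p, g)] => [x|]; rewrite ?big_seq1 // inE => /eqP->.
Qed.

Lemma ideal_gen_sub G M p :
  up_closed M -> (forall g, G g -> supported M g) -> ideal_gen G p ->
  supported M p.
Proof.
move=> Mup GM [s Gs ->]; rewrite big_seq; apply: supported_sum => x xs.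
apply: (@supportedM _ _ (fun=> True) M) (GM _ (Gs x xs)) => // m1 m2 _ Mm2.
by apply: Mup Mm2 _; rewrite lem_addl.
Qed.

Lemma ideal_gen_sup G M p :
  (forall m, M m -> exists2 q, 'X_[m] = q.1 * q.2 & G q.2) ->
  supported M p -> ideal_gen G p.
Proof.
move=> MG Mp; rewrite (mpolyE p) big_seq; elim/big_rec: _ => [|m q mp].
  exact: ideal_gen0.
have [[c g] /= -> Gg] := MG m (Mp m mp); apply: ideal_genD.
by rewrite scalerAl; apply: ideal_genM.
Qed.

(** This reduces every question on a monomial ideal to the up-closed set of
    exponents of its monomials. *)
Lemma monomial_ideal_genE A p :
  monomial_ideal_gen A p <-> supported (above A) p.
Proof.
split.
  apply: ideal_gen_sub; first exact: above_up.
  by move=> g [m Am ->]; apply/supportedX; exists m; rewrite ?lepm_refl.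
apply: ideal_gen_sup => m [a Aa am].
by exists ('X_[m - a], 'X_[a]); rewrite /= -?mpolyXD ?submK //; exists a.
Qed.

Lemma generatesP A I : generates A I <-> forall p, I p <-> supported (above A) p.
Proof.
by split=> H p; rewrite ?H ?monomial_ideal_genE //; have [] := H p.
Qed.

Section Fixed.
Variables (I : S -> Prop) (monI : monomial_ideal I).

Definition mons : 'X_{1..n} -> Prop := fun m => I 'X_[m].

Lemma mons_above A : generates A I -> forall m, mons m <-> above A m.
Proof. by move=> /generatesP H m; rewrite /mons H supportedX. Qed.

Lemma mons_up : up_closed mons.
Proof.
have [A /mons_above AE] := monI.
by move=> a b /AE Ma ab; apply/AE; apply: above_up Ma ab.
Qed.

Lemma monomial_idealP p : I p <-> supported mons p.
Proof.
have [A AE] := monI; have MA := mons_above AE; move/generatesP: AE => ->.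
by split=> H m /H; rewrite MA.
Qed.

Lemma mingens_above m : mons m -> exists2 u, 
   (mons u /\ forall v, mons v -> (v <= u)%MM -> v = u) & (u <= m)%MM.
Proof.
have [d] := ubnP (mdeg m); elim: d m => // d IH m md Mm.
case: (classic (forall v, mons v -> (v <= m)%MM -> v = m)) => [H|].
  by exists m; rewrite ?lepm_refl.
move=> /not_all_ex_not[v nv]; have [Mv nvm] := imply_to_and _ _ nv.
have [vm ne] := imply_to_and _ _ nvm.
have [|u Hu uv] := IH v _ Mv.
  apply: (@leq_trans (mdeg m)); last by rewrite -ltnS.
  have: mdeg (m - v) != 0%N.
    rewrite mdeg_eq0; apply: contra_not_neq ne.
    by move=> E; rewrite -(submK vm) E add0m.
  by have := congr1 mdeg (submK vm); rewrite mdegD; lia.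
by exists u => //; apply: lepm_trans vm.
Qed.

(** [G(I)] in terms of divisibility alone: an element of a generating set that is
    a proper multiple of another monomial of the ideal could be left out. *)
Lemma mingensP u :
  mingens I u <-> mons u /\ forall v, mons v -> (v <= u)%MM -> v = u.
Proof.
split.
  move=> [A [AI Amin] Au]; have MA := mons_above AI; split.
    by apply/MA; exists u; rewrite ?lepm_refl.
  move=> v /MA[a Aa av] vu; apply: NNPP => ne.
  have au : a <> u.
    move=> E; apply: ne; apply/mnmP=> i; apply/eqP; rewrite eqn_leq.
    by rewrite (mnm_lepP vu) -E (mnm_lepP av).
  have [||_ //] := Amin (fun m => A m /\ m <> u) _ _ u Au.
    by move=> m [].
  apply/generatesP => p; rewrite ((generatesP _ _).1 AI p).
  split=> H m /H [b]; last by case=> Ab _ bm; exists b.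
  have [->|/eqP bu] := eqVneq b u; last by exists b.
  by move=> _ um; exists a => //; apply: lepm_trans um; apply: lepm_trans vu.
move=> Hu; pose A u := mons u /\ forall v, mons v -> (v <= u)%MM -> v = u.
have AM m : above A m <-> mons m.
  split=> [[a [Ma _]]|/mingens_above //]; exact: mons_up.
exists A => //; split.
  by apply/generatesP=> p; rewrite monomial_idealP; split=> H m /H /AM.
move=> B BA BI m [Mm Am].
by have /(mons_above BI)[b Bb bm] := Mm; rewrite -(Am b) //; apply: (BA b Bb).1.
Qed.

Lemma mingens_below m : mons m -> exists2 u, mingens I u & (u <= m)%MM.
Proof. by case/mingens_above=> u /mingensP; exists u. Qed.

Lemma mingens_mons u : mingens I u -> mons u.
Proof. by case/mingensP. Qed.

Lemma mingens_deg u v : single_degree I -> mingens I u -> mons v ->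
  mdeg v = mdeg u -> mingens I v.
Proof.
move=> sd Iu /mingens_below[w Iw wv] vu.
suff <- : w = v by [].
have : mdeg (v - w) = 0%N.
  have := sd _ _ Iw Iu; have := congr1 mdeg (submK wv); rewrite mdegD; lia.
by move/eqP; rewrite mdeg_eq0 => /eqP E; rewrite -(submK wv) E add0m.
Qed.

End Fixed.

Implicit Types (C : {set 'I_n}).

Definition restrict C m : 'X_{1..n} := [multinom if i \in C then 0%N else m i | i < n].

Lemma restrictE C m i : restrict C m i = if i \in C then 0%N else m i.
Proof. exact: mnmE. Qed.

Definition localized C M a : Prop :=
  exists2 m, M m & (restrict C m <= a)%MM.

Lemma prime_of_var C i : prime_of (K := K) C 'X_i <-> i \notin C.
Proof.
split=> [|iC]; last first.
  by rewrite -['X_i]mul1r; apply: ideal_genM; exists i.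
pose V m := exists2 j, j \notin C & m = U_(j)%MM :> 'X_{1..n}.
move=> Xi; have /supportedX[m [j jC ->]] : supported (above V) ('X_i : S).
  apply: ideal_gen_sub Xi; first exact: above_up.
  move=> g [j jC ->]; apply/supportedX; exists U_(j)%MM; rewrite ?lepm_refl //.
  by exists j.
by rewrite lep1mP mnm1E; have [->|] := eqVneq i j.
Qed.

(** Hence localizing at a prime ideal involves a single set of inverted
    variables. *)
Lemma prime_of_inj C C' : same_ideal (prime_of (K := K) C) (prime_of C') -> C = C'.
Proof.
move=> H; apply/setP=> i; apply: negb_inj; apply/idP/idP.
  by move/prime_of_var/H/prime_of_var.
by move/prime_of_var/H/prime_of_var.
Qed.

Lemma subst_one_mon C m : subst_one C 'X_[m] = 'X_[K, restrict C m].
Proof.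
rewrite /subst_one comp_mpolyX (mpolyXE_id _ (restrict C m)).
apply: eq_bigr => i _; rewrite tnth_mktuple mnmE.
by case: ifP => _; rewrite ?expr1n ?expr0.
Qed.

Lemma localizationP I P C : monomial_ideal I -> same_ideal P (prime_of C) ->
  forall p, localization I P p <-> supported (localized C (mons I)) p.
Proof.
move=> monI PC p; split.
  apply: ideal_gen_sub.
    by move=> a b [m Mm ma] ab; exists m => //; apply: lepm_trans ab.
  move=> g [C' [q [PC' Iq ->]]].
  have -> : C' = C.
    by apply: prime_of_inj => r; split=> [/PC'/PC|/PC/PC'].
  rewrite /subst_one comp_mpolyEX big_seq; apply: supported_sum => m mq.
  move=> a /msuppZ_le; rewrite -/(subst_one C _) subst_one_mon msuppX inE => /eqP->.
  by exists m; rewrite ?lepm_refl //; apply: (proj1 (monomial_idealP monI q) Iq).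
apply: ideal_gen_sup => a [m Mm ma].
exists ('X_[a - restrict C m], 'X_[restrict C m]).
  by rewrite /= -mpolyXD submK.
by exists C, 'X_[m]; split=> //; rewrite subst_one_mon.
Qed.

End MonomialIdeals.

(** * Exchange properties *)

Section Exchange.
Context {n : nat}.
Implicit Types (B M : 'X_{1..n} -> Prop) (u v m : 'X_{1..n}) (i j k l : 'I_n).
Implicit Types (C D : {set 'I_n}).

Lemma exchangeE u i j l : exchange u i j l = (u l - (i == l) + (j == l))%N.
Proof. by rewrite /exchange mnmDE mnmBE !mnm1E. Qed.

Lemma exchangeD u i j : (0 < u i)%N ->
  (exchange u i j + U_(i) = u + U_(j))%MM.
Proof.
move=> ui; apply/mnmP=> l; rewrite mnmDE exchangeE mnmDE !mnm1E.
case: (eqVneq i l) => [il|_] /=; last by lia.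
by rewrite -il; lia.
Qed.

Lemma mdeg_exchange u i j : (0 < u i)%N -> mdeg (exchange u i j) = mdeg u.
Proof. by move/(exchangeD j)/(congr1 mdeg); rewrite !mdegD !mdeg1; lia. Qed.

Definition weight C m : nat := (\sum_(l in C) m l)%N.

Lemma weightD C u v : weight C (u + v)%MM = (weight C u + weight C v)%N.
Proof. by rewrite -big_split; apply: eq_bigr => l _; rewrite mnmDE. Qed.

Lemma weight1 C i : weight C U_(i)%MM = (i \in C).
Proof.
rewrite /weight; have [iC|iC] := boolP (i \in C).
  rewrite (bigD1 i) //= mnm1E eqxx big1 // => l /andP[_ li].
  by rewrite mnm1E eq_sym (negPf li).
rewrite big1 // => l lC; rewrite mnm1E; case: eqVneq => // E.
by rewrite E lC in iC.
Qed.

Lemma weight_exchange C u i j : (0 < u i)%N ->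
  (weight C (exchange u i j) + (i \in C) = weight C u + (j \in C))%N.
Proof.
by move/(exchangeD j)/(congr1 (weight C)); rewrite !weightD !weight1.
Qed.

Lemma weight_mdeg C u : (weight C u + weight (~: C) u = mdeg u)%N.
Proof.
rewrite mdegE /weight [RHS](bigID (mem C)) /=; congr (_ + _)%N.
by apply: eq_bigl => l; rewrite inE.
Qed.

Lemma mdeg_restrict C u : mdeg (restrict C u) = weight (~: C) u.
Proof.
rewrite mdegE /weight [RHS]big_mkcond; apply: eq_bigr => l _.
by rewrite restrictE inE; case: (l \in C).
Qed.

Lemma weight_ltP C u v : (weight C u < weight C v)%N ->
  exists2 i, i \in C & (u i < v i)%N.
Proof.
move=> uv; apply: NNPP => H; move: uv; rewrite ltnNge => /negP; apply.
apply: leq_sum => i iC; rewrite leqNgt; apply/negP => ui; apply: H.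
by exists i.
Qed.

Definition has_degree B (d : nat) : Prop := forall u, B u -> mdeg u = d.

Definition strongly_exchanging B : Prop := forall u v, B u -> B v ->
  forall i j, (v i < u i)%N -> (u j < v j)%N -> B (exchange u i j).

(** The generators of a localization: those generators that have the largest
    total degree in the inverted variables, these being then erased. *)
Definition localized_gens C B w : Prop :=
  exists2 u, B u /\ (forall v, B v -> (weight C v <= weight C u)%N) &
    w = restrict C u.

Lemma restrict_le C u v :
  (restrict C u <= v)%MM <-> forall i, i \notin C -> (u i <= v i)%N.
Proof.
split=> [/mnm_lepP H i iC|H].
  by have := H i; rewrite restrictE (negPf iC).
by apply/mnm_lepP=> i; rewrite restrictE; case: ifPn => // /H.
Qed.

(** Exchanging a variable outside [C] for one in [C] increases the weight and
    decreases the part outside [C]. As long as some [v] has larger weight such an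
    exchange towards [v] exists, because [u] and [v] have the same degree. *)
Lemma maximal_weight C B d u : has_degree B d -> strongly_exchanging B -> B u ->
  exists2 w, localized_gens C B w & (w <= restrict C u)%MM.
Proof.
move=> Bd Bx; have [m] := ubnP (d - weight C u)%N.
elim: m u => // m IH u um Bu.
case: (classic (forall v, B v -> (weight C v <= weight C u)%N)) => [H|].
  by exists (restrict C u); rewrite ?lepm_refl //; exists u.
move=> /not_all_ex_not[v nv]; have [Bv uv] := imply_to_and _ _ nv.
have {}uv : (weight C u < weight C v)%N by rewrite ltnNge; apply/negP.
have [j jC uvj] := weight_ltP uv.
have [|i iC vui] := @weight_ltP (~: C) v u.
  by have := weight_mdeg C u; have := weight_mdeg C v; rewrite !Bd //; lia.
have iC' : (i \in C) = false by move: iC; rewrite inE => /negPf.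
have Bw := Bx _ _ Bu Bv _ _ vui uvj.
have [|w Cw wu] := IH (exchange u i j) _ Bw.
  have := @weight_exchange C u i j; rewrite iC' jC.
  have := weight_mdeg C v; rewrite (Bd v) //; lia.
exists w => //; apply: (lepm_trans wu); apply/restrict_le => l lC.
rewrite exchangeE restrictE (negPf lC); case: (eqVneq j l) lC => [<-|_ _].
  by rewrite jC.
by rewrite addn0 leq_subr.
Qed.

Lemma localized_gensP C B M d : has_degree B d -> strongly_exchanging B ->
  (forall m, M m <-> above B m) ->
  forall a, localized C M a <-> above (localized_gens C B) a.
Proof.
move=> Bd Bx MB a; split.
  move=> [m /MB[u Bu um] ma].
  have [w Cw wu] := maximal_weight C Bd Bx Bu.
  exists w => //; apply: (lepm_trans wu); apply: lepm_trans ma.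
  apply/restrict_le => i iC; rewrite restrictE (negPf iC); exact: (mnm_lepP um).
move=> [w [u [Bu _] ->] ua]; exists u => //.
by apply/MB; exists u; rewrite ?lepm_refl.
Qed.

Lemma localized_gens_degree C B d : has_degree B d ->
  exists d', has_degree (localized_gens C B) d'.
Proof.
move=> Bd; case: (classic (exists w, localized_gens C B w)) => [[w]|]; last first.
  by move=> H; exists 0%N => w Bw; case: H; exists w.
move=> [u [Bu umax] _]; exists (d - weight C u)%N => x [v [Bv vmax] ->].
rewrite mdeg_restrict -(Bd v Bv) -(weight_mdeg C v).
by have := umax v Bv; have := vmax u Bu; lia.
Qed.

Lemma localized_gens_exchanging C B :
  strongly_exchanging B -> strongly_exchanging (localized_gens C B).
Proof.
move=> Bx w1 w2 [u [Bu umax] ->] [v [Bv vmax] ->] i j.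
rewrite !restrictE; case: (boolP (i \in C)) => // iC; case: (boolP (j \in C)) => // jC.
move=> vui uvj; exists (exchange u i j).
  split; first exact: Bx Bu Bv _ _ vui uvj.
  move=> x /umax; have := @weight_exchange C u i j.
  by rewrite (negPf iC) (negPf jC); lia.
apply/mnmP=> l; rewrite exchangeE !restrictE exchangeE.
case: ifPn => // lC; rewrite sub0n add0n.
by case: eqVneq lC => // <-; rewrite (negPf jC).
Qed.

(** If no monomial above [g] is a socle element modulo [M] for the variables of
    [D], then a monomial outside [M] can be multiplied again and again by
    variables of [D] without entering [M], hence by all powers of one of them.
    Read contrapositively, this is a downward induction from the region where
    some coordinate has reached [g + t]. *)
Lemma saturation D M g : up_closed M ->
  (forall b, (g <= b)%MM -> (forall i, i \notin D -> b i = g i) ->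
     (forall i, i \in D -> M (b + U_(i))%MM) -> M b) ->
  (forall i, i \in D -> exists t, M (g + U_(i) *+ t)%MM) -> M g.
Proof.
move=> Mup Msoc MD.
have [t tP] : exists t : 'I_n -> nat, forall i, i \in D -> M (g + U_(i) *+ t i)%MM.
  apply: (@fin_all_exists _ (fun=> nat) (fun i t => i \in D -> M (g + U_(i) *+ t)%MM)).
  move=> i; case: (boolP (i \in D)) => [/MD[x Mx]|_]; last by exists 0%N.
  by exists x.
suff H N b : (g <= b)%MM -> (forall i, i \notin D -> b i = g i) ->
    (\sum_(i in D) (g i + t i - b i) < N)%N -> M b.
  by apply: (H _ g _ _ (leqnn _)); rewrite ?lepm_refl.
elim: N b => // N IH b gb bD bN.
case: (classic (exists2 i, i \in D & (g i + t i <= b i)%N)) => [[i iD bi]|H].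
  apply: Mup (tP i iD) _; apply/mnm_lepP=> l; rewrite mnmDE mulmnE mnm1E.
  have [<-|_] := eqVneq i l; first by rewrite mul1n.
  by rewrite mul0n addn0; apply/mnm_lepP.
apply: Msoc => // i iD; apply: IH.
- by apply: (lepm_trans gb); rewrite lem_addr.
- move=> l lD; rewrite mnmDE mnm1E bD //.
  by have [E|_] := eqVneq i l; rewrite ?addn0 // -E iD in lD *.
apply: (@leq_trans (\sum_(l in D) (g l + t l - b l))%N); last by rewrite -ltnS.
rewrite (bigD1 i) // [in X in (_ < X)%N](bigD1 i) //= -addSn; apply: leq_add.
  have : ~ (g i + t i <= b i)%N by move=> E; apply: H; exists i.
  by rewrite mnmDE mnm1E eqxx; lia.
by apply: leq_sum => l _; rewrite mnmDE; lia.
Qed.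

End Exchange.

Section Exchange3.
Implicit Types (B M : 'X_{1..3} -> Prop) (u v m a b : 'X_{1..3}).
Implicit Types (i j k l : 'I_3).

Lemma mdeg3 i j k m : i != j -> i != k -> j != k ->
  mdeg m = (m i + m j + m k)%N.
Proof.
move=> ij ik jk; rewrite mdegE (bigD1 i) //= (bigD1 j) 1?eq_sym //=.
rewrite (bigD1 k) /= ?(eq_sym k) ?ik ?jk // big1 ?addn0 ?addnA //.
move=> l; have := ord3P ij ik jk l.
by case=> ->; rewrite !eqxx ?andbF.
Qed.

Lemma third i j : i != j -> exists2 k, i != k & j != k.
Proof.
case: (fintype.pickP (fun k => (i != k) && (j != k))) => [k /andP[]|H] ij.
  by exists k.
exfalso; move: (H ord0) (H (@Ordinal 3 1 isT)) (H (@Ordinal 3 2 isT)) ij.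
rewrite -!(inj_eq val_inj) /=; lia.
Qed.

(** In three variables the exchange property implies its strong form. The only
    doubtful case is that of two coordinates [j], [k] with larger exponents in
    [v]; then exchanges in [v] can only raise the exponent of [i], so they
    move [v] to [u / x_i * x_j]. *)
Lemma polymatroid_strong B d : has_degree B d ->
  (forall u v, B u -> B v -> forall i, (v i < u i)%N ->
     exists2 j, (u j < v j)%N & B (exchange u i j)) ->
  strongly_exchanging B.
Proof.
move=> Bd Bx u v Bu Bv i j vui uvj.
have ij : i != j by apply/eqP=> E; move: vui uvj; rewrite E; lia.
have [k ik jk] := third ij.
have degE := fun m => mdeg3 m ij ik jk.
have [vuk|uvk] := leqP (v k) (u k).
  have [l uvl] := Bx _ _ Bu Bv _ vui.
  by have [E|->|E] := ord3P ij ik jk l => //; move: uvl; rewrite E; lia.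
have [N] := ubnP (v j + v k)%N.
have {uvk} uvk := ltnW uvk.
elim: N v Bv {vui} uvj uvk => // N IH v Bv uvj uvk vN.
have du := Bd u Bu; have dv := Bd v Bv; rewrite degE in du; rewrite degE in dv.
have step l : l != i -> (u l < v l)%N -> B (exchange v l i).
  move=> li uvl; have [l' vul'] := Bx _ _ Bv Bu _ uvl.
  by have [->|E|E] := ord3P ij ik jk l' => //; move: vul'; rewrite E; lia.
have [uvk'|vuk] := ltnP (u k) (v k).
  apply: (IH _ (step k _ uvk')); rewrite 1?eq_sym //;
    rewrite !exchangeE ?eqxx ?(negPf ij) ?(negPf ik) ?(negPf jk)
      ?(eq_sym k) ?(negPf jk); lia.
have [uvj'|vuj] := ltnP (u j).+1 (v j).
  apply: (IH _ (step j _ uvj)); rewrite 1?eq_sym //;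
    rewrite !exchangeE ?eqxx ?(negPf ij) ?(negPf ik) ?(negPf jk); lia.
suff -> : exchange u i j = v by [].
apply/mnmP=> l; rewrite exchangeE.
have [->|->|->] := ord3P ij ik jk l;
  rewrite ?eqxx ?(negPf ij) ?(negPf ik) ?(negPf jk) ?(eq_sym j i) ?(negPf ij); lia.
Qed.

(** Dividing by variables without leaving the localization stops only in degree
    [d]. *)
Lemma localized_ge M C (d : int) :
  (forall a, localized C M a -> (mdeg a)%:Z <> d ->
     exists i b, a = (b + U_(i))%MM /\ localized C M b) ->
  forall a, localized C M a -> (d <= (mdeg a)%:Z).
Proof.
move=> T0 a; have [N] := ubnP (mdeg a); elim: N a => // N IH a aN La.
have [->//|/eqP ne] := eqVneq (mdeg a)%:Z d.
have [i [b [E Lb]]] := T0 a La ne; move: aN; rewrite E mdegD mdeg1 => aN.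
by have := IH b _ Lb; lia.
Qed.

Lemma localized_set0 M a : up_closed M -> localized set0 M a <-> M a.
Proof.
move=> Mup; split=> [[m Mm ma]|Ma].
  apply: Mup Mm _; apply/mnm_lepP=> i; apply: ((restrict_le _ _ _).1 ma i).
  by rewrite inE.
by exists a => //; apply/restrict_le.
Qed.

Lemma localized_ray M k g : up_closed M ->
  localized [set k] M g -> exists t, M (g + U_(k) *+ t)%MM.
Proof.
move=> Mup [m Mm /restrict_le mg]; exists (m k); apply: Mup Mm _.
apply/mnm_lepP=> l; rewrite mnmDE mulmnE mnm1E.
have [<-|kl] := eqVneq k l; first by rewrite mul1n leq_addl.
by rewrite mul0n addn0; apply: mg; rewrite inE eq_sym.
Qed.

(** The first hypothesis says that localizations have no generators outside the
    expected degree, the other two that they have no top syzygies outside theirs.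
    Suppose that the exchanged monomial [g] is not in the ideal. By saturation it
    stays outside the localization at some variable [x_k]: there the degree bound
    needed for a second saturation holds because [g k] is between [u k] and [v k].
    Hence [g] stays outside the localization at [x_k] and a second variable, where
    only the exponent of the third variable matters; but that exponent is at least
    the one of [u] or of [v], which both lie in the ideal. *)
Lemma linear_strong_exchange M (d : {set 'I_3} -> int) : up_closed M ->
  (forall C a, localized C M a -> (mdeg a)%:Z <> d C ->
     exists i b, a = (b + U_(i))%MM /\ localized C M b) ->
  (forall b i j k, i != j -> i != k -> j != k -> b k = 0%N ->
     localized [set k] M (b + U_(i))%MM -> localized [set k] M (b + U_(j))%MM ->
     (mdeg b + 2)%:Z <> d [set k] + 1 -> localized [set k] M b) ->
  (forall b, (forall i, M (b + U_(i))%MM) ->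
     (mdeg b + 3)%:Z <> d set0 + 2 -> M b) ->
  forall u v, M u -> M v -> (mdeg u)%:Z = d set0 -> (mdeg v)%:Z = d set0 ->
  forall i j, (v i < u i)%N -> (u j < v j)%N -> M (exchange u i j).
Proof.
move=> Mup T0 T1 T2 u v Mu Mv du dv i j vui uvj.
have ij : i != j by apply/eqP=> E; move: vui uvj; rewrite E; lia.
set g := exchange u i j.
have gE l : (minn (u l) (v l) <= g l <= maxn (u l) (v l))%N.
  rewrite /g exchangeE; have [<-|_] := eqVneq i l.
    by rewrite eq_sym (negPf ij); lia.
  by have [<-|_] := eqVneq j l; lia.
have dg : (mdeg g)%:Z = d set0 by rewrite mdeg_exchange //; lia.
apply: NNPP => Mg; apply: (Mg); apply: (@saturation _ [set: 'I_3]) => //.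
  move=> b gb _ Mb; apply: T2 => [l|]; first by apply: Mb; rewrite inE.
  have := congr1 mdeg (submK gb); rewrite mdegD; lia.
move=> k _; apply: localized_ray => //.
pose g0 := restrict [set k] g.
suff [m Mm mg0] : localized [set k] M g0.
  exists m => //; apply: (lepm_trans mg0); apply/restrict_le => l _; exact: leqnn.
have dk w : mdeg (restrict [set k] w) = (mdeg w - w k)%N.
  by rewrite mdeg_restrict -(weight_mdeg [set k] w) /weight big_set1 addKn.
have gek w : M w -> d [set k] <= (mdeg w - w k)%N%:Z.
  move=> Mw; rewrite -dk; apply: localized_ge (T0 _) _ _.
  by exists w; rewrite ?lepm_refl.
have g0d : d [set k] <= (mdeg g0)%:Z.
  rewrite dk; have := gek u Mu; have := gek v Mv; have := gE k; lia.
apply: (@saturation _ (~: [set k])).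
- by move=> a b [m Mm ma] ab; exists m => //; apply: lepm_trans ab.
- move=> b g0b bk Mb.
  have [k1 kk1] : exists k1, k != k1.
    by exists (if k == ord0 then ord_max else ord0); case: (eqVneq k ord0) => [->|].
  have [k2 kk2 k12] := third kk1.
  have k1k : k1 != k by rewrite eq_sym.
  have k2k : k2 != k by rewrite eq_sym.
  apply: (T1 b k1 k2 k k12 k1k k2k); rewrite ?inE //.
  + by rewrite bk ?inE ?eqxx // restrictE inE eqxx.
  + by apply: Mb; rewrite !inE.
  + by apply: Mb; rewrite !inE.
  have := congr1 mdeg (submK g0b); rewrite mdegD; lia.
move=> k1; rewrite !inE eq_sym => kk1.
have [k2 kk2 k12] := third kk1.
have [w Mw wg] : exists2 w, M w & (w k2 <= g k2)%N.
  have [uv|vu] := leqP (u k2) (v k2); first by exists u => //; have := gE k2; lia.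
  by exists v => //; have := gE k2; lia.
exists (w k1), w => //; apply/restrict_le => l; rewrite !inE.
rewrite mnmDE restrictE inE mulmnE mnm1E.
have [->|->|->] := ord3P kk1 kk2 k12 l; rewrite ?eqxx //.
  by rewrite mul1n leq_addl.
by move=> _; rewrite eq_sym (negPf kk2); apply: leq_trans wg (leq_addr _ _).
Qed.

End Exchange3.

(** * Linear resolutions by iterated mapping cones *)

Section Cone.
Context {K : fieldType} {n : nat}.
Local Notation S := {mpoly K[n]}.
Implicit Types (L V : S -> Prop) (u : 'X_{1..n}) (c : S).

Lemma scalar_mx0 m : 0%:M = 0 :> 'M[S]_m.
Proof. exact: raddf0. Qed.

Definition linear_free_resolution (d : int) L : Prop :=
  exists2 F : augmented_sequence K n, graded_free_resolution F L &
    forall i k, @shift _ _ F i k = i%:Z + d.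

(** All basis elements of [F_i] sit in degree [i + d], so elsewhere already the
    terms of the tensored complex vanish, and with them its homology. *)
Lemma linear_free_resolution_linear d L :
  linear_free_resolution d L -> linear_resolution L.
Proof.
move=> [F Fr Fs]; exists d => i j ji; exists F => // v Hv _.
have -> : v = 0.
  apply/rowP=> k; rewrite mxE; apply/eqP; apply: contraNT ji => vk.
  by rewrite -(Hv k vk) Fs.
by exists 0; rewrite ?mul0mx // => k; rewrite mxE eqxx.
Qed.

Lemma eq_linear_free_resolution d L V : (forall p, V p <-> L p) ->
  linear_free_resolution d L -> linear_free_resolution d V.
Proof.
by move=> VL [F [Fg FL Fe] Fs]; exists F => //; split=> // p; rewrite VL.
Qed.

Lemma linear_free_resolution0 d : linear_free_resolution d (fun p : S => p = 0).
Proof.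
exists (@AugmentedSequence K n (fun=> 0%N) (fun i _ => i%:Z + d) (fun=> 0) 0) => //.
split.
- by split=> [[]//|i []].
- move=> p; split=> [->|[v]]; first by exists 0; rewrite mul0mx scalar_mx0.
  by rewrite mulmx0 => /matrixP/(_ 0 0); rewrite !mxE eqxx.
- move=> i v; split=> _; first by exists 0; apply/rowP=> -[]//.
  by case: i v => [|i] v /=; rewrite mulmx0.
Qed.

(** Used twice to build the comparison map of a mapping cone in the right
    degrees. *)
Lemma mx_lift r (c : nat) k (s : 'I_r -> int) (t : 'I_c -> int) (A : 'M[S]_(r, c))
    (B : 'M[S]_(k, c)) e :
  hommx s t A -> (forall x, homrow t e (row x B)) ->
  (forall x, exists w, row x B = w *m A) ->
  exists2 W, (forall x, homrow s e (row x W)) & B = W *m A.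
Proof.
move=> HA HB BA.
have H (x : 'I_k) : exists w, homrow s e w /\ row x B = w *m A.
  have [w wE] := BA x; have [|w' Hw' w'E] := homog_lift (e := e) (w := w) HA.
    by rewrite -wE.
  by exists w'; rewrite w'E.
have [f fE] := fin_all_exists H.
exists (\matrix_x f x) => [x|]; first by rewrite rowK; case: (fE x).
by apply/row_matrixP=> x; rewrite row_mul rowK; case: (fE x).
Qed.

(** Exactness of a mapping cone at a spot where both complexes are exact; the
    equation on [f0] and [f1] says that [f] is a chain map up to sign. *)
Lemma cone_exact a0 a1 a2 k0 k1 k2 (D0 : 'M[S]_(a1, a0)) (D1 : 'M[S]_(a2, a1))
    (Y0 : 'M[S]_(k1, k0)) (Y1 : 'M[S]_(k2, k1)) (f0 : 'M[S]_(k1, a0))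
    (f1 : 'M[S]_(k2, a1)) :
  (forall v : 'rV_a1, v *m D0 = 0 <-> exists w, v = w *m D1) ->
  (forall v : 'rV_k1, v *m Y0 = 0 <-> exists w, v = w *m Y1) ->
  f1 *m D0 + Y1 *m f0 = 0 ->
  forall v : 'rV_(a1 + k1), v *m block_mx D0 0 f0 Y0 = 0 <->
    exists w, v = w *m block_mx D1 0 f1 Y1.
Proof.
move=> HD HY Hf v; rewrite -[v]hsubmxK; move: (lsubmx v) (rsubmx v) => a b {v}.
rewrite mul_row_block mulmx0 add0r.
split.
  rewrite -row_mx0 => /eq_row_mx[E /HY[w2 bE]].
  have [|w1 aE] := (HD (a - w2 *m f1)).1.
    rewrite mulmxBl -mulmxA; move/eqP: Hf; rewrite addr_eq0 => /eqP ->.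
    by rewrite mulmxN opprK mulmxA -bE.
  exists (row_mx w1 w2); rewrite mul_row_block mulmx0 add0r -aE bE.
  by rewrite subrK.
move=> [w]; rewrite -[w]hsubmxK mul_row_block mulmx0 add0r.
move=> /eq_row_mx[-> ->]; rewrite mulmxDl -addrA -!mulmxA -mulmxDr Hf mulmx0.
rewrite addr0 mulmxA (HD _).2 ?mulmxA ?(HY _).2 ?row_mx0 //.
- by exists (rsubmx w).
- by exists (lsubmx w).
Qed.

(** The end of the cone: the hypothesis on [U] says that [X] generates the colon
    ideal, that is the kernel of [S -> S/L] given by the new generator. *)
Lemma cone_exact0 a1 a2 k2 (A : 'cV[S]_a1) (D1 : 'M[S]_(a2, a1))
    (U : 'M[S]_1) (X : 'cV[S]_k2) (f : 'M[S]_(k2, a1)) :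
  (forall v : 'rV_a1, v *m A = 0 <-> exists w, v = w *m D1) ->
  (forall (a : 'rV_a1) b, a *m A + b *m U = 0 -> exists w, b = w *m X) ->
  f *m A + X *m U = 0 ->
  forall v : 'rV_(a1 + 1), v *m col_mx A U = 0 <->
    exists w, v = w *m block_mx D1 0 f X.
Proof.
move=> HD HU Hf v; rewrite -[v]hsubmxK; move: (lsubmx v) (rsubmx v) => a b {v}.
rewrite mul_row_col; split.
  move=> E; have [w2 bE] := HU a b E.
  have [|w1 aE] := (HD (a - w2 *m f)).1.
    rewrite mulmxBl -mulmxA; move/eqP: Hf; rewrite addr_eq0 => /eqP ->.
    by rewrite mulmxN opprK mulmxA -bE.
  exists (row_mx w1 w2); rewrite mul_row_block mulmx0 add0r -aE bE.
  by rewrite subrK.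
move=> [w]; rewrite -[w]hsubmxK mul_row_block mulmx0 add0r.
move=> /eq_row_mx[-> ->]; rewrite mulmxDl -addrA -!mulmxA -mulmxDr Hf mulmx0.
by rewrite addr0 mulmxA (HD _).2 //; exists (lsubmx w).
Qed.

Definition homogeneous (e : nat) c : Prop := supported (fun m => mdeg m = e) c.

(** [V] has a resolution [0 -> S^r -> S^q -> V] by linear forms, such as the
    Koszul resolution of an ideal generated by at most two variables. *)
Definition koszul_resolved V : Prop :=
  exists q r (X : 'cV[S]_q) (Y : 'M[S]_(r, q)),
  [/\ forall x, homogeneous 1 (X x 0), forall x y, homogeneous 1 (Y x y),
      forall c, V c <-> exists v, c%:M = v *m X,
      forall v : 'rV_q, v *m X = 0 <-> exists w, v = w *m Y
    & forall w : 'rV_r, w *m Y = 0 -> w = 0].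

Section Step.
Variables (F : augmented_sequence K n) (q r : nat).
Variables (f0 : 'M[S]_(q, rank F 0)) (f1 : 'M[S]_(r, rank F 1)).
Variables (X : 'cV[S]_q) (Y : 'M[S]_(r, q)) (d : int) (u : 'X_{1..n}).

(** The ranks, differentials and comparison maps of a complex that ends after
    three terms. The indices are shifted by one, as [F] resolves an ideal and not
    the quotient by it. *)
Definition cone_rank i : nat :=
  match i with 0 => 1 | 1 => q | 2 => r | _ => 0 end.

Definition cone_diff i : 'M[S]_(cone_rank i.+1, cone_rank i) :=
  match i with 0 => X | 1 => Y | _ => 0 end.

Definition cone_map i : 'M[S]_(cone_rank i.+1, rank F i) :=
  match i with 0 => f0 | 1 => f1 | _ => 0 end.

Definition cone : augmented_sequence K n :=
  @AugmentedSequence K n (fun i => rank F i + cone_rank i)%N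
    (fun i _ => i%:Z + d)
    (fun i => block_mx (diff F i) 0 (cone_map i) (cone_diff i))
    (col_mx (augm F) ('X_[u])%:M).

End Step.

Lemma homogeneous_row (k : nat) (s : 'I_k -> int) (e e' : int) (a : nat) (v : 'rV[S]_k) :
  (forall x, s x = e) -> e' = e + a%:Z ->
  homrow s e' v <-> forall x, homogeneous a (v 0 x).
Proof.
move=> sE ->; split=> H x; apply: (supportedW (H x)) => m; rewrite sE; lia.
Qed.

(** Adding a generator [x^u] to [L]: the kernel of [S -> S/L], [c |-> c x^u], is the
    colon ideal, so the mapping cone of a comparison map from its resolution to
    that of [L] resolves the sum. The comparison map lifts to linear forms because
    the resolution of the colon ideal consists of linear forms and [u] has the
    degree of the generators of [L]. *)
Lemma linear_quotient_step (d : nat) L V u :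
  linear_free_resolution d%:Z L -> mdeg u = d ->
  koszul_resolved (fun c => L (c * 'X_[u])) ->
  (forall p, V p <-> exists p1 c, L p1 /\ p = p1 + c * 'X_[u]) ->
  linear_free_resolution d%:Z V.
Proof.
move=> [F [Fg FL Fe] Fs] du [q [r [X [Y [Xh Yh HX HXY HY]]]]] VE.
have FaH := Fg.1; have FdH := Fg.2.
(* The signs make the two squares anticommute, as the cone requires. *)
have [f0 f0h f0E] : exists2 f : 'M[S]_(q, rank F 0),
    (forall x y, homogeneous 1 (f x y)) & - (X *m ('X_[u])%:M) = f *m augm F.
  have [||x|W Wh WE] := @mx_lift _ _ q (@shift _ _ F 0) (fun=> 0) (augm F)
     (- (X *m ('X_[u])%:M)) (d%:Z + 1).
  - by move=> k l m; rewrite ord1 => /FaH ->; rewrite add0r.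
  - move=> x; apply/(@homogeneous_row _ _ 0 _ d.+1) => // [|y]; first by lia.
    rewrite ord1 !mxE big_ord1 mxE eqxx mulr1n; apply: supportedN.
    apply/supportedMX; apply: (supportedW (Xh x)) => m; rewrite mdegD du; lia.
  - have [|v vE] := (FL (- (X x 0 * 'X_[u]))).1.
      rewrite -mulNr; apply/HX; exists (- delta_mx 0 x).
      rewrite mulNmx -rowE; apply/matrixP=> a b; rewrite !ord1 !mxE eqxx.
      by rewrite mulr1n.
    exists v; rewrite -vE; apply/matrixP=> a b; rewrite !ord1 !mxE big_ord1.
    by rewrite mxE eqxx !mulr1n.
  exists W => // x y; have /homogeneous_row := Wh x.
  move=> /(_ 1%N d%:Z) H; have := H _ _ y; rewrite mxE; apply; last by lia.
  by move=> z; rewrite Fs; lia.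
have [f1 f1h f1E] : exists2 f : 'M[S]_(r, rank F 1),
    (forall x y, homogeneous 1 (f x y)) & - (Y *m f0) = f *m diff F 0.
  have [||x|W Wh WE] := @mx_lift _ _ r (@shift _ _ F 1) (@shift _ _ F 0) (diff F 0)
     (- (Y *m f0)) (d%:Z + 2).
  - by move=> k l m /FdH.
  - move=> x; apply/(@homogeneous_row _ _ d%:Z _ 2) => // y.
    rewrite !mxE; apply: supportedN; apply: supported_sum => z _.
    by apply: supportedM (Yh x z) (f0h z y) => m1 m2 E1 E2; rewrite mdegD E1 E2.
  - apply/(Fe 0%N) => /=; rewrite -row_mul mulNmx -mulmxA -f0E mulmxN opprK.
    rewrite mulmxA !row_mul (HXY _).2 ?mul0mx //.
    by exists (delta_mx 0 x); rewrite rowE.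
  exists W => // x y; have /homogeneous_row := Wh x.
  move=> /(_ 1%N (d%:Z + 1)) H; have := H _ _ y; rewrite mxE; apply; last by lia.
  by move=> z; rewrite Fs; lia.
exists (cone f0 f1 X Y d%:Z u) => //; split.
- split.
    move=> k m; rewrite /= mxE; case: split => l.
      by move/FaH <-; rewrite Fs.
    rewrite ord1 mxE eqxx mulr1n msuppX inE => /eqP->; rewrite du; lia.
  have H1 i k l : homogeneous 1 (diff F i k l).
    by move=> m /FdH; rewrite !Fs; lia.
  have H0 : homogeneous 1 0 by exact: supported0.
  have H2 i k l : homogeneous 1 (cone_map f0 f1 i k l).
    case: i k l => [|[|i]] k l /=; [exact: f0h|exact: f1h|].
    by rewrite mxE.
  have H3 i k l : homogeneous 1 (cone_diff X Y i k l).
    case: i k l => [|[|i]] k l /=; [|exact: Yh|by rewrite mxE].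
    by rewrite (ord1 l); exact: Xh.
  move=> i k l m mkl; suff -> : mdeg m = 1%N by rewrite /=; lia.
  suff : homogeneous 1 (diff (cone f0 f1 X Y d%:Z u) i k l) by apply.
  rewrite /= mxE; case: split => a; rewrite mxE; case: split => b; rewrite ?mxE.
  - exact: H1.
  - exact: H0.
  - exact: (H2 i a b).
  - exact: (H3 i a b).
- move=> p; rewrite VE; split.
    move=> [p1 [c [/FL[v vE] ->]]]; exists (row_mx v c%:M).
    by rewrite /= mul_row_col -vE -scalar_mxM raddfD.
  move=> [w] /=; rewrite -[w]hsubmxK mul_row_col => E.
  exists ((lsubmx w *m augm F) 0 0), ((rsubmx w : 'M_1) 0 0); split.
    by apply/FL; exists (lsubmx w); rewrite -mx11_scalar.
  have := E; rewrite [rsubmx w]mx11_scalar -scalar_mxM => /matrixP/(_ 0 0).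
  by rewrite !mxE eqxx !mulr1n.
case=> [|i] v /=.
  apply: (@cone_exact0 _ _ q (augm F) (diff F 0) ('X_[u])%:M X f0).
  - exact: (Fe 0%N).
  - move=> a b; rewrite [b]mx11_scalar -scalar_mxM => E; apply/HX/FL.
    exists (- a); rewrite mulNmx; apply/eqP; rewrite -addr_eq0 addrC.
    exact/eqP.
  by rewrite -f0E addNr.
apply: cone_exact; first exact: (Fe i.+1).
  case: i {v} => [|[|i]] v /=.
  - exact: HXY.
  - split=> [/HY->|[w ->]]; first by exists 0; rewrite mul0mx.
    by rewrite mulmx0 mul0mx.
  split=> _; first by exists 0; rewrite mul0mx; apply/rowP=> -[]//.
  by rewrite mulmx0.
case: i {v} => [|[|i]] /=; rewrite ?mul0mx ?addr0 //.
by rewrite -f1E addNr.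
Qed.

Lemma eq_koszul_resolved V W : (forall p, W p <-> V p) ->
  koszul_resolved V -> koszul_resolved W.
Proof.
move=> WV [q [r [X [Y [H1 H2 H3 H4 H5]]]]]; exists q, r, X, Y.
by split=> // c; rewrite WV.
Qed.

Lemma homogeneousX i : homogeneous 1 ('X_i : S).
Proof. by apply/supportedX; rewrite mdeg1. Qed.

Lemma koszul_resolved0 : koszul_resolved (fun c => c = 0).
Proof.
exists 0%N, 0%N, 0, 0; split=> [[]//|[]//|c|v|w _].
- split=> [->|[v]]; first by exists 0; rewrite mul0mx scalar_mx0.
  by rewrite mulmx0 => /matrixP/(_ 0 0); rewrite !mxE eqxx.
- by split=> _; [exists 0; apply/rowP; case | exact: mulmx0].
- by apply/rowP=> -[]//.
Qed.

Lemma koszul_resolved1 i :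
  koszul_resolved (fun c => exists a, c = a * 'X_i).
Proof.
exists 1%N, 0%N, ('X_i)%:M, 0; split=> [x|[]//|c|v|w _].
- by rewrite ord1 mxE eqxx; apply: homogeneousX.
- split=> [[a ->]|[v E]]; first by exists a%:M; rewrite -scalar_mxM.
  exists (v 0 0); move: E; rewrite [v]mx11_scalar -scalar_mxM.
  by move=> /matrixP/(_ 0 0); rewrite !mxE eqxx.
- split=> [E|[w ->]]; last by rewrite mulmx0 mul0mx.
  exists 0; rewrite mulmx0 [v]mx11_scalar; move: E; rewrite [v]mx11_scalar.
  rewrite -scalar_mxM => /matrixP/(_ 0 0); rewrite !mxE eqxx !mulr1n => E.
  have -> : v 0 0 = 0 by apply: (@mulXI _ _ i); rewrite E mul0r.
  exact: scalar_mx0.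
- by apply/rowP=> -[]//.
Qed.

Lemma koszul_resolved2 i j : i != j ->
  koszul_resolved (fun c => exists a b, c = a * 'X_i + b * 'X_j).
Proof.
move=> ij; pose X : 'cV[S]_(1 + 1) := col_mx ('X_i)%:M ('X_j)%:M.
pose Y : 'M[S]_(1, 1 + 1) := row_mx ('X_j)%:M (- 'X_i)%:M.
have XE a b : row_mx a%:M b%:M *m X = (a * 'X_i + b * 'X_j)%:M.
  by rewrite mul_row_col -!scalar_mxM raddfD.
have YE a : a%:M *m Y = row_mx (a * 'X_j)%:M (- a * 'X_i)%:M.
  by rewrite mul_mx_row -!scalar_mxM mulrN mulNr.
have rowE (v : 'rV[S]_(1 + 1)) : exists a b, v = row_mx a%:M b%:M.
  exists (lsubmx v 0 0), (rsubmx v 0 0); rewrite -!mx11_scalar hsubmxK //.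
have sE (a b : S) : a%:M = b%:M :> 'M_1 -> a = b.
  by move=> /matrixP/(_ 0 0); rewrite !mxE eqxx.
exists (1 + 1)%N, 1%N, X, Y; split.
- move=> x; rewrite mxE; case: (split x) => y; rewrite ord1 mxE eqxx;
  exact: homogeneousX.
- move=> x y; rewrite mxE; case: (split y) => z; rewrite !ord1 mxE eqxx.
    exact: homogeneousX.
  by apply: supportedN; apply: homogeneousX.
- move=> c; split=> [[a [b ->]]|[v]].
    by exists (row_mx a%:M b%:M); rewrite XE.
  by have [a [b ->]] := rowE v; rewrite XE => /sE ->; exists a, b.
- move=> v; have [a [b ->]] := rowE v; rewrite XE; split.
    rewrite -scalar_mx0 => /sE /(koszul2 ij)[w [-> ->]].
    by exists w%:M; rewrite YE.
  move=> [w]; rewrite [w]mx11_scalar YE => /eq_row_mx[/sE -> /sE ->].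
  by rewrite -scalar_mx0; congr _%:M; ring.
- move=> w; rewrite [w]mx11_scalar YE -row_mx0 -!scalar_mx0 => /eq_row_mx[/sE E _].
  by congr _%:M; apply: (@mulXI _ _ j); rewrite E mul0r.
Qed.

Lemma koszul_resolved_vars (s : seq 'I_n) : uniq s -> (size s <= 2)%N ->
  koszul_resolved (supported (fun m => has (fun j => 0 < m j)%N s)).
Proof.
case: s => [|i [|j [|//]]] /=.
- move=> _ _; apply: eq_koszul_resolved koszul_resolved0 => p.
  split=> [H|-> m]; last by rewrite msupp0.
  apply/eqP; rewrite -msupp_eq0; case E: (msupp p) => [//|m s].
  by have := H m; rewrite E mem_head => /(_ isT).
- move=> _ _; apply: eq_koszul_resolved (koszul_resolved1 i) => p.
  have H := @supported_dvdP K n p U_(i)%MM.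
  split=> [Hp|/H Hp].
    by apply/H; apply: (supportedW Hp) => m; rewrite orbF lep1mP lt0n.
  by apply: (supportedW Hp) => m; rewrite orbF lep1mP lt0n.
rewrite inE andbT => ij _.
apply: eq_koszul_resolved (koszul_resolved2 ij) => p; split=> [Hp|[a [b ->]]].
  have [a [q [pE Hq]]] := div_var i p.
  have /supported_dvdP[b qE] : supported (fun m => (U_(j) <= m)%MM) q.
    apply: (supportedW (Hq _ Hp)) => m [+ m0].
    by rewrite m0 ltnn orbF lep1mP lt0n.
  by exists a, b; rewrite pE qE.
apply: supportedD; apply/supportedMX => m _; rewrite !mnmDE !mnm1E eqxx ?orbT //.
Qed.

End Cone.

(** * Linear quotients of strongly exchanging sets *)

Section LinearQuotients.
Context {K : fieldType}.
Local Notation S := {mpoly K[3]}.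
Implicit Types (B : 'X_{1..3} -> Prop) (s : seq 'X_{1..3}) (u v w m : 'X_{1..3}).

(** Classical comprehension in a list, for predicates without a decision
    procedure. *)
Lemma finite_subset (T : eqType) (s : seq T) (A : T -> Prop) :
  exists t : seq T, forall x, x \in t <-> x \in s /\ A x.
Proof.
elim: s => [|y s [t tE]]; first by exists [::] => x; split=> [|[]].
case: (classic (A y)) => Ay.
  exists (y :: t) => x; rewrite !inE; split.
    by case/orP=> [/eqP->|/tE[-> Ax]]; rewrite ?eqxx ?orbT.
  by case=> /orP[->//|xs] Ax; apply/orP; right; apply/tE.
exists t => x; rewrite inE tE; split=> [[-> Ax]|[/orP[/eqP->//|xs] Ax]] //.
by rewrite orbT.
Qed.

Lemma enum_degree B d : has_degree B d ->
  exists2 s, sorted <%O s & forall w, w \in s <-> B w.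
Proof.
move=> Bd; pose e := [seq bmnm x | x <- enum {: 'X_{1..3 < d.+1}}].
have [t tE] := finite_subset e B.
exists (sort <=%O (undup t)); first by rewrite sort_lt_sorted undup_uniq.
move=> w; rewrite mem_sort mem_undup tE; split=> [[]//|Bw]; split=> //.
have wd : (mdeg w < d.+1)%N by rewrite Bd.
by apply/mapP; exists (BMultinom wd); rewrite ?mem_enum.
Qed.

Definition colon_vars s u : seq 'I_3 :=
  [seq j : 'I_3 <- enum 'I_3 | [exists i : 'I_3,
     [&& (j < i)%N, (0 < u i)%N & exchange u i j \in s]]].

(** The last variable never occurs, as no variable comes after it. This is where
    three variables matter: the colon ideals need at most two generators. *)
Lemma size_colon_vars s u : (size (colon_vars s u) <= 2)%N.
Proof.
have sub : {subset colon_vars s u <= [:: ord0; @Ordinal 3 1 isT]}.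
  move=> j; rewrite mem_filter => /andP[/existsP[i /and3P[ji _ _]] _].
  rewrite !inE -!(inj_eq val_inj) /=; have := ltn_ord i; lia.
by apply: (uniq_leq_size _ sub); rewrite filter_uniq ?enum_uniq.
Qed.

(** The colon ideal of the monomials lexicographically above [u] by [x^u] is
    generated by variables. If [x^v] divides [x^u x^m] with [v] above [u], let [j]
    be the first coordinate where they differ. Some later exponent of [u] exceeds
    that of [v], and exchanging it for [x_j] gives a monomial of [B] that is above
    [u] and divides [x^u x_j]. *)
Lemma colon_varsP B d s u m : has_degree B d -> strongly_exchanging B ->
  B u -> (forall v, v \in s <-> B v /\ (u < v)%O) ->
  above (fun v => v \in s) (u + m)%MM <->
  has (fun j => 0 < m j)%N (colon_vars s u).
Proof.
move=> Bd Bx Bu sE; split.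
  move=> [v /sE[Bv uv] vum].
  have /ltmcP[|j jlt uvj] := uv; first by rewrite !Bd.
  have [i vui] : exists i, (v i < u i)%N.
    apply: NNPP => H; have : mdeg u = mdeg v by rewrite !Bd.
    suff : (mdeg u < mdeg v)%N by lia.
    rewrite !mdegE (bigD1 j) // [X in (_ < X)%N](bigD1 j) //= -addSn.
    apply: leq_add => //; apply: leq_sum => l _.
    by rewrite leqNgt; apply/negP=> vul; apply: H; exists l.
  have ji : (j < i)%N.
    rewrite ltnNge leq_eqVlt; apply/negP=> /orP[/eqP/val_inj E|/jlt E].
      by move: vui uvj; rewrite E; lia.
    by move: vui; rewrite E ltnn.
  have Bw := Bx _ _ Bu Bv _ _ vui uvj.
  apply/hasP; exists j; last first.
    by have := mnm_lepP vum j; rewrite mnmDE; lia.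
  rewrite mem_filter mem_enum andbT; apply/existsP; exists i.
  rewrite ji (leq_trans _ vui) //=; apply/sE; split=> //.
  apply/ltmcP; first by rewrite mdeg_exchange // (leq_trans _ vui).
  exists j => [l lj|]; rewrite exchangeE.
    have -> : (i == l) = false by apply/eqP=> E; rewrite E in ji; lia.
    have -> : (j == l) = false by apply/eqP=> E; rewrite E in lj; lia.
    by rewrite subn0 addn0.
  have -> : (i == j) = false by apply/eqP=> E; rewrite E in ji; lia.
  by rewrite eqxx subn0 addn1.
move=> /hasP[j]; rewrite mem_filter => /andP[/existsP[i /and3P[ji ui us]] _] mj.
exists (exchange u i j) => //; apply/mnm_lepP=> l; rewrite exchangeE mnmDE.
by have [<-|_] := eqVneq j l; lia.
Qed.

Lemma supported_split A A' (p : S) :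
  supported (fun m => A m \/ A' m) p <->
  exists p1 p2, [/\ supported A p1, supported A' p2 & p = p1 + p2].
Proof.
split; last first.
  move=> [p1 [p2 [H1 H2 ->]]]; apply: supportedD.
    by apply: (supportedW H1); left.
  by apply: (supportedW H2); right.
move=> Hp; have [t tE] := finite_subset (msupp p) A.
exists (mfilter (fun m => m \in t) p), (mfilter (fun m => m \notin t) p).
split; last exact: mfilter_split.
  by move=> m; rewrite msupp_mfilter => /andP[_ /tE[]].
move=> m; rewrite msupp_mfilter => /andP[mp mt].
by case: (Hp m mp) => // Am; case/negP: mt; apply/tE.
Qed.

(** The elements of [B] are added to the ideal from the lexicographically largest
    down; the list is kept upward closed in [B] so that [colon_varsP] applies. *)
Lemma strongly_exchanging_linear B d : has_degree B d -> strongly_exchanging B ->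
  linear_free_resolution d%:Z (supported (K := K) (above B)).
Proof.
move=> Bd Bx; have [s0 s0s s0B] := enum_degree Bd.
suff H : forall s, sorted <%O s -> (forall u, u \in s -> B u) ->
    (forall u v, u \in s -> B v -> (u < v)%O -> v \in s) ->
    linear_free_resolution d%:Z (supported (K := K) (above (fun w => w \in s))).
  apply: eq_linear_free_resolution (H s0 s0s _ _) => [p|u /s0B|u v _ Bv _] //;
    last exact/s0B.
  by split=> Hp; apply: (supportedW Hp) => m [u /s0B Bu um]; exists u.
elim=> [|u s IH] /= us sB sup.
  apply: eq_linear_free_resolution (linear_free_resolution0 _) => p.
  split=> [H|-> m]; last by rewrite msupp0.
  apply/eqP; rewrite -msupp_eq0; case E: (msupp p) => [//|m t].
  by have [|v] := H m; rewrite ?E ?mem_head.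
have sE v : v \in s <-> B v /\ (u < v)%O.
  split=> [vs|[Bv uv]].
    split; first by apply: sB; rewrite inE vs orbT.
    by have /allP := order_path_min lt_trans us; apply.
  have := sup u v (mem_head _ _) Bv uv; rewrite inE => /orP[/eqP E|//].
  by rewrite E ltxx in uv.
have Bu : B u by apply: sB; rewrite mem_head.
apply: (@linear_quotient_step _ _ d (supported (above (fun w => w \in s))) _ u).
- apply: IH; first exact: path_sorted us.
    by move=> v vs; apply: sB; rewrite inE vs orbT.
  move=> v w /sE[_ uv] Bw vw; apply/sE; split=> //; exact: lt_trans uv vw.
- exact: Bd.
- apply: eq_koszul_resolved (koszul_resolved_vars _ (size_colon_vars s u)).
    move=> c; rewrite supportedMX.
    by split=> Hc; apply: (supportedW Hc) => m /(colon_varsP _ Bd Bx Bu sE).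
  by rewrite filter_uniq ?enum_uniq.
move=> p; split.
  move=> Hp; have /supported_split[p1 [p2 [H1 /supported_dvdP[c ->] ->]]] :
      supported (fun m => above (fun w => w \in s) m \/ (u <= m)%MM) p.
    apply: (supportedW Hp) => m [w]; rewrite inE => /orP[/eqP->|ws] wm.
      by right.
    by left; exists w.
  by exists p1, c.
move=> [p1 [c [H1 ->]]]; apply: supportedD.
  by apply: (supportedW H1) => m [w ws wm]; exists w; rewrite // inE ws orbT.
apply/supportedMX => m _; exists u; first exact: mem_head.
exact: lem_addr.
Qed.

End LinearQuotients.

(** * The equivalence *)

Section Equivalence.
Context {K : fieldType}.
Local Notation S := {mpoly K[3]}.
Variables (I : S -> Prop) (monI : monomial_ideal I).

Lemma mingens_has_degree : single_degree I ->
  exists d, has_degree (mingens I) d.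
Proof.
move=> sd; case: (classic (exists u, mingens I u)) => [[u Iu]|H].
  by exists (mdeg u) => v Iv; apply: sd.
by exists 0%N => u Iu; case: H; exists u.
Qed.

Lemma mons_mingens m : mons I m <-> above (mingens I) m.
Proof.
split=> [Im|[u /(mingens_mons monI) Iu um]]; first exact: mingens_below.
exact: mons_up Iu um.
Qed.

Lemma mingens_exchange u i j : single_degree I -> mingens I u ->
  (0 < u i)%N -> I 'X_[exchange u i j] <-> mingens I (exchange u i j).
Proof.
move=> sd Iu ui; split=> [Iw|]; last exact: mingens_mons.
by apply: mingens_deg Iu Iw _ => //; apply: mdeg_exchange.
Qed.

Lemma polymatroidal_strong : polymatroidal I -> strong_exchange I.
Proof.
move=> [_ sd Ix]; have [d Id] := mingens_has_degree sd; split=> //.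
move=> u v Iu Iv i j vui uvj.
apply: mingens_mons => //; apply: (polymatroid_strong Id _ Iu Iv vui uvj).
move=> w x Iw Ix' k xwk; have [l wxl Iwl] := Ix _ _ Iw Ix' _ xwk.
exists l => //; apply/mingens_exchange => //; exact: leq_trans xwk.
Qed.

Lemma strong_exchange_localization : strong_exchange I ->
  forall P, monomial_prime P -> linear_resolution (localization I P).
Proof.
move=> [_ sd Ix] P [C PC]; have [d Id] := mingens_has_degree sd.
have Bx : strongly_exchanging (mingens I).
  move=> u v Iu Iv i j vui uvj; apply/mingens_exchange => //.
    exact: leq_trans vui.
  exact: Ix Iu Iv _ _ vui uvj.
have [d' Cd] := localized_gens_degree C Id.
have := strongly_exchanging_linear (K := K) Cd (localized_gens_exchanging (C := C) Bx).
move/eq_linear_free_resolution => H; apply: linear_free_resolution_linear; apply: H => p.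
rewrite (localizationP monI PC).
by split=> Hp; apply: (supportedW Hp) => m /(localized_gensP C Id Bx mons_mingens).
Qed.

Lemma linear_localizations_strong :
  (forall P, monomial_prime P -> linear_resolution (localization I P)) ->
  strong_exchange I.
Proof.
move=> H.
have D (C : {set 'I_3}) : exists d0 : int, forall (i : nat) (j : int),
    j != i%:Z + d0 -> tor_vanishes (localization I (prime_of C)) i j.
  by apply: H; exists C.
have [d dP] := fin_all_exists D.
have LE C := localizationP (C := C) monI (fun p => iff_refl (prime_of C p)).
have Iup := mons_up monI.
have T0 C a : localized C (mons I) a -> (mdeg a)%:Z <> d C ->
    exists i b, a = (b + U_(i))%MM /\ localized C (mons I) b.
  move=> La ne; apply: tor0_generator (LE C) (dP C 0%N (mdeg a)%:Z _) _ La => //.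
  by rewrite add0r; apply/eqP.
have Ideg u : mingens I u -> (mdeg u)%:Z = d set0.
  move/(mingensP monI) => [Iu umin]; apply: NNPP => ne.
  have [|i [b [uE /(localized_set0 b Iup) Ib]]] := T0 set0 u _ ne.
    exact/localized_set0.
  have := umin b Ib; rewrite uE lem_addr => /(_ isT) /(congr1 mdeg).
  by rewrite mdegD mdeg1; lia.
split=> // [u v /Ideg ud /Ideg vd|u v Iu Iv i j vui uvj]; first by lia.
apply: (linear_strong_exchange (d := d) Iup T0) vui uvj; last 4 first.
- exact: mingens_mons.
- exact: mingens_mons.
- exact: Ideg.
- exact: Ideg.
- move=> b i' j' k ij ik jk bk Lbi Lbj ne.
  apply: tor1_syzygy ij ik jk (LE _) (dP [set k] 1%N _ _) erefl bk Lbi Lbj.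
  by apply/eqP; move: ne; lia.
move=> b Ib ne; apply/(localized_set0 b Iup).
apply: tor2_socle (LE _) (dP set0 2%N _ _) erefl _; first by apply/eqP; move: ne; lia.
by move=> i'; apply/localized_set0.
Qed.

Lemma strong_exchange_polymatroidal : strong_exchange I -> polymatroidal I.
Proof.
move=> [_ sd Ix]; split=> // u v Iu Iv i vui.
have [j _ uvj] : exists2 j, j \in ~: [set i] & (u j < v j)%N.
  apply: weight_ltP; have := sd _ _ Iu Iv.
  rewrite -(weight_mdeg [set i] u) -(weight_mdeg [set i] v).
  rewrite ![weight [set i] _]big_set1.
  by move: (weight _ u) (weight _ v) => a b; lia.
by exists j => //; apply: Ix Iu Iv _ _ vui uvj.
Qed.

End Equivalence.

Local Close Scope ring_scope.

Theorem proposition2p7 (K : fieldType) (I : {mpoly K[3]} -> Prop)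
    (monI : monomial_ideal I) :
  (polymatroidal I <-> polymatroidal I /\ strong_exchange I) /\
  (polymatroidal I <->
     forall P : {mpoly K[3]} -> Prop,
       monomial_prime P -> linear_resolution (localization I P)).
Proof.
split; split.
- by move=> PI; split=> //; apply: polymatroidal_strong.
- by case.
- by move/(polymatroidal_strong monI)/(strong_exchange_localization monI).
- by move/(linear_localizations_strong monI)/(strong_exchange_polymatroidal monI).
Qed.
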